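(* For each infinite field $\mathrm{k}$ and each integer $n\ge 1$, the group $\mathrm{Bir}_{\mathbb{P}^n}(\mathrm{k})$ is topologically simple when endowed with the Zariski topology, i.e. it does not contain any non-trivial closed normal strict subgroup: if $N\subseteq \mathrm{Bir}_{\mathbb{P}^n}(\mathrm{k})$ is a normal subgroup that is closed in the Zariski topology, then $N=\{\mathrm{id}\}$ or $N=\mathrm{Bir}_{\mathbb{P}^n}(\mathrm{k})$.
   Context: For a field $\mathrm{k}$, $\mathrm{Bir}_{\mathbb{P}^n}(\mathrm{k})$ (the Cremona group of rank $n$) is the group of birational transformations of $\mathbb{P}^n$ defined over $\mathrm{k}$. Morphisms to $\mathrm{Bir}_X$. Let $\mathrm{k}$ be a field with algebraic closure $\overline{\mathrm{k}}$, let $X$ be a geometrically irreducible algebraic variety over $\mathrm{k}$, and let $A$ be an algebraic variety over $\mathrm{k}$. Consider an $A$-birational transformation $f$ of $A\times X$ which (over $\overline{\mathrm{k}}$) induces an isomorphism $U\to V$, where $U,V$ are open subsets of $A\times X$ whose projections to $A$ are surjective. For each $\overline{\mathrm{k}}$-point $a$ of $A$ it gives $f_a\in \mathrm{Bir}_X(\overline{\mathrm{k}})$, $x\mapsto p_2(f(a,x))$, where $p_2\colon A\times X\to X$ is the second projection. The map $a\mapsto f_a$ is called a $\overline{\mathrm{k}}$-morphism $A\to \mathrm{Bir}_X$. If $f$ is defined over $\mathrm{k}$, it is called a $\mathrm{k}$-morphism $A\to \mathrm{Bir}_X$ (a morphism defined over $\mathrm{k}$); it then yields a map $A(\mathrm{k}')\to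 \mathrm{Bir}_X(\mathrm{k}')$ for every field extension $\mathrm{k}\subset \mathrm{k}'$. Zariski topology. A subset $F\subseteq \mathrm{Bir}_X(\mathrm{k})$ is closed in the Zariski topology if for every algebraic variety $A$ over $\mathrm{k}$ and every $\mathrm{k}$-morphism $A\to \mathrm{Bir}_X$, the preimage of $F$ in $A(\mathrm{k})$ is closed (for the Zariski topology of $A(\mathrm{k})$). *)

(* Defs.v *)
From HB Require Import structures.
From mathcomp Require Import all_boot all_order all_algebra generic_quotient.
From mathcomp Require Import boolp classical_sets cardinality.
From mathcomp Require Import mpoly.
Set Implicit Arguments.
Unset Strict Implicit.
Unset Printing Implicit Defensive.
Import GRing.Theory.
Local Open Scope ring_scope.
Local Open Scope quotient_scope.

Section Cremona.
Variables (k : fieldType) (n : nat).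

(* The tuple (h_0, ..., h_n) stands for the rational self-map
   x |-> [h_0(x) : ... : h_n(x)] of P^n when it satisfies is_hmap below. *)
Definition ptuple := n.+1.-tuple {mpoly k[n.+1]}.

Definition is_hmap (F : ptuple) : Prop :=
  (exists i, tnth F i != 0) /\ (exists d, forall i, tnth F i \is d.-homog).

(* Equality of [P_0 : ... : P_n] and [Q_0 : ... : Q_n]; this is meaningful only
   when neither tuple is zero. *)
Definition hsim (P Q : ptuple) : Prop :=
  forall i j, tnth P i * tnth Q j = tnth P j * tnth Q i.

Definition hcomp (F G : ptuple) : ptuple := [tuple tnth F i \mPo G | i < n.+1].

Definition hid : ptuple := [tuple 'X_i | i < n.+1].

Definition hinverse (F G : ptuple) : Prop :=
  [/\ is_hmap G,
      (exists i, tnth (hcomp F G) i != 0) /\ hsim (hcomp F G) hid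
    & (exists i, tnth (hcomp G F) i != 0) /\ hsim (hcomp G F) hid].

Definition is_birational (F : ptuple) : Prop :=
  is_hmap F /\ exists G, hinverse F G.

Record birrep := BirRep { birval :> ptuple; _ : `[< is_birational birval >] }.
HB.instance Definition _ := [isSub for birval].
HB.instance Definition _ := [Choice of birrep by <:].

Lemma birrepP (f : birrep) : is_birational f.
Proof. by case: f => F /= /asboolP. Qed.

Definition mkbir (F : ptuple) (h : is_birational F) : birrep :=
  BirRep (asboolT h).

Let nz (F : ptuple) := exists i, tnth F i != 0.

Lemma hsim_refl P : hsim P P.
Proof. by move=> i j; rewrite mulrC. Qed.

Lemma hsim_sym P Q : hsim P Q -> hsim Q P.
Proof. by move=> h i j; rewrite ![tnth Q _ * _]mulrC -h. Qed.

Lemma hsim_trans P Q R : nz Q -> hsim P Q -> hsim Q R -> hsim P R.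
Proof.
move=> [l nzl] PQ QR i j; apply: (mulfI nzl).
by rewrite mulrCA mulrA PQ -mulrA QR mulrA -PQ -mulrA mulrCA.
Qed.

Lemma hsim_scale P Q (c e : {mpoly k[n.+1]}) : c != 0 ->
  (forall i, c * tnth P i = e * tnth Q i) -> hsim P Q.
Proof.
move=> nzc h i j; apply: (mulfI nzc).
by rewrite !mulrA !h -!mulrA [tnth Q i * _]mulrC.
Qed.

Lemma homog_scale d (p : {mpoly k[n.+1]}) (c : {mpoly k[n.+1]}) (G : ptuple) :
  p \is d.-homog ->
  p \mPo [tuple c * tnth G i | i < n.+1] = c ^+ d * (p \mPo G).
Proof.
move=> /dhomogP hp; rewrite !comp_mpolyE mulr_sumr big_seq [RHS]big_seq.
apply: eq_bigr => m /hp hm; rewrite -scalerAr; congr (_ *: _).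
under eq_bigr do rewrite tnth_mktuple exprMn.
rewrite big_split /= prodrXr; congr (_ ^+ _ * _); rewrite -mdegE; exact: hm.
Qed.

Lemma homog_comp d e (p : {mpoly k[n.+1]}) (G : ptuple) :
  p \is d.-homog -> (forall i, tnth G i \is e.-homog) ->
  p \mPo G \is (e * d)%N.-homog.
Proof.
move=> /dhomogP hp hG; rewrite comp_mpolyE big_seq; apply: rpred_sum => m /hp.
move=> hm; have <- : mdeg m = d by exact: hm.
rewrite mdegE; apply: rpredZ.
rewrite big_distrr /=; elim/big_ind2: _ => //=; first exact: dhomog1.
  by move=> p1 d1 p2 d2; apply: dhomogM.
by move=> i _; apply: dhomogMn.
Qed.

Lemma hcompA F G H : hcomp F (hcomp G H) = hcomp (hcomp F G) H.
Proof.
apply: eq_from_tnth => i; rewrite !tnth_mktuple.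
rewrite comp_mpolyE (comp_mpolyE (tnth F i) G) raddf_sum /=.
apply: eq_bigr => m _.
rewrite comp_mpolyZ rmorph_prod; congr (_ *: _); apply: eq_bigr => j _.
by rewrite rmorphXn /= tnth_mktuple.
Qed.

Lemma hcomp1l F : hcomp hid F = F.
Proof.
apply: eq_from_tnth => i; rewrite !tnth_mktuple comp_mpolyXU.
by rewrite -tnth_nth.
Qed.

Lemma hcomp1r F : hcomp F hid = F.
Proof. by apply: eq_from_tnth => i; rewrite tnth_mktuple comp_mpoly_id. Qed.

(* F(P) and F(Q) are proportional, with nonzero coefficients, when P and Q
   are. *)
Lemma hcomp_prop F P Q : is_hmap F -> nz P -> nz Q -> hsim P Q ->
  exists c e : {mpoly k[n.+1]}, [/\ c != 0, e != 0 &
    forall i, c * tnth (hcomp F P) i = e * tnth (hcomp F Q) i].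
Proof.
move=> [_ [d hF]] [l nzl] [l' nzl'] PQ.
have nQl : tnth Q l != 0.
  apply: contraNneq nzl' => Q0; have := PQ l l'; rewrite Q0 mulr0 => /eqP.
  by rewrite mulf_eq0 (negPf nzl) orFb; apply.
exists (tnth Q l ^+ d), (tnth P l ^+ d).
split; [exact: expf_neq0 | exact: expf_neq0 | move=> i].
rewrite !tnth_mktuple -!homog_scale //; congr (_ \mPo _).
by apply: eq_from_tnth => j; rewrite !tnth_mktuple mulrC PQ.
Qed.

Lemma hcomp_simr F P Q : is_hmap F -> nz P -> nz Q -> hsim P Q ->
  hsim (hcomp F P) (hcomp F Q).
Proof.
by move=> hF nP nQ /(hcomp_prop hF nP nQ)[c [e [nc _]]]; apply: hsim_scale.
Qed.

Lemma hcomp_siml F G P : hsim F G -> hsim (hcomp F P) (hcomp G P).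
Proof. by move=> FG i j; rewrite !tnth_mktuple -!rmorphM /= FG. Qed.

Lemma hcomp_nz_sim F P Q : is_hmap F -> nz P -> nz Q -> hsim P Q ->
  nz (hcomp F P) -> nz (hcomp F Q).
Proof.
move=> hF nP nQ /(hcomp_prop hF nP nQ)[c [e [nc ne h]]] [i ni]; exists i.
apply: contraNneq ni => F0; have := h i; rewrite F0 mulr0 => /eqP.
by rewrite mulf_eq0 (negPf nc) orFb; apply.
Qed.

Lemma nz_hid : nz hid.
Proof. by exists ord0; rewrite tnth_mktuple -msupp_eq0 msuppX. Qed.

Lemma hmap_hid : is_hmap hid.
Proof.
by split; [exact: nz_hid | exists 1%N => i; rewrite tnth_mktuple dhomogX; apply/eqP; exact: mdeg1].
Qed.

(* A birational map composed with any homogeneous tuple having a right inverse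
   is nonzero. *)
Lemma hcomp_nz F G G' : is_hmap F -> nz (hcomp G G') ->
  hsim (hcomp G G') hid -> nz (hcomp F G).
Proof.
move=> hF nGG sGG; have : nz (hcomp F (hcomp G G')).
  apply: (hcomp_nz_sim hF nz_hid nGG (hsim_sym sGG)).
  by rewrite hcomp1r; case: hF.
rewrite hcompA => -[i ni]; exists i; apply: contraNneq ni.
by move=> F0; rewrite tnth_mktuple F0 comp_mpoly0.
Qed.

Lemma hmap_hcomp F G : is_hmap F -> is_hmap G -> nz (hcomp F G) ->
  is_hmap (hcomp F G).
Proof.
move=> [_ [d hF]] [_ [e hG]] nFG; split=> //; exists (e * d)%N => i.
by rewrite tnth_mktuple; apply: homog_comp.
Qed.

Lemma hcomp_inverse F F' G G' : is_hmap F -> is_hmap G ->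
  hinverse F F' -> hinverse G G' ->
  nz (hcomp (hcomp F G) (hcomp G' F')) /\
  hsim (hcomp (hcomp F G) (hcomp G' F')) hid.
Proof.
move=> hF hG [hF' [nF sF] [nF' sF']] [hG' [nG sG] [nG' sG']].
have nzF' : nz F' by case: hF'.
have eqc : hcomp (hcomp F G) (hcomp G' F') = hcomp F (hcomp (hcomp G G') F').
  by rewrite -!hcompA.
have nG'F' : nz (hcomp G' F') by apply: (hcomp_nz hG' nF' sF').
have s1 : hsim F' (hcomp (hcomp G G') F').
  by rewrite -[X in hsim X _]hcomp1l; apply: hcomp_siml; apply: hsim_sym.
have hGG : is_hmap (hcomp G G') := hmap_hcomp hG hG' nG.
have n1 : nz (hcomp (hcomp G G') F') by apply: (hcomp_nz hGG nF' sF').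
rewrite eqc; split; first exact (hcomp_nz_sim hF nzF' n1 s1 nF).
exact (hsim_trans nF (hsim_sym (hcomp_simr hF nzF' n1 s1)) sF).
Qed.

Lemma bir_hid : is_birational hid.
Proof.
split; first exact: hmap_hid.
exists hid; split; rewrite ?hcomp1l; first exact: hmap_hid.
  by split; [exact: nz_hid | exact: hsim_refl].
by split; [exact: nz_hid | exact: hsim_refl].
Qed.

Lemma hinverse_sym F G : is_hmap F -> hinverse F G -> hinverse G F.
Proof. by move=> hF [hG h1 h2]; split. Qed.

Lemma bir_hcomp_nz F G : is_birational F -> is_birational G -> nz (hcomp F G).
Proof. by move=> [hF _] [_ [G' [_ [nG sG] _]]]; apply: (hcomp_nz hF nG sG). Qed.

Lemma bir_hcomp F G :
  is_birational F -> is_birational G -> is_birational (hcomp F G).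
Proof.
move=> bF bG; have nFG := bir_hcomp_nz bF bG.
case: bF bG => hF [F' iF] [hG [G' iG]].
split; first exact: hmap_hcomp.
have [[hF' _ [nF' sF']] [hG' _ _]] := (iF, iG).
exists (hcomp G' F'); split.
- exact (hmap_hcomp hG' hF' (hcomp_nz hG' nF' sF')).
- exact (hcomp_inverse hF hG iF iG).
- exact (hcomp_inverse hG' hF' (hinverse_sym hG iG) (hinverse_sym hF iF)).
Qed.

Lemma bir_hinv (F : birrep) : {G : ptuple | hinverse F G}.
Proof. by apply: cid; case: (birrepP F). Qed.

Lemma hinverse_bir (F : birrep) G : hinverse F G -> is_birational G.
Proof.
case: (birrepP F) => hF _ iG; split; first by case: iG.
by exists F; apply: hinverse_sym.
Qed.

Definition bireq (f g : birrep) : bool := `[< hsim f g >].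

Lemma birrep_nz (f : birrep) : nz f.
Proof. by case: (birrepP f) => -[]. Qed.

Lemma bireq_is_equiv : equiv_class_of bireq.
Proof.
split.
- by move=> f; apply/asboolP; exact: hsim_refl.
- by move=> f g; apply: asbool_equiv_eq; split; apply: hsim_sym.
- move=> g f h /asboolP fg /asboolP gh; apply/asboolP.
  exact: (hsim_trans (birrep_nz g)).
Qed.

Canonical bireq_equiv := EquivRelPack bireq_is_equiv.

(* Bir_{P^n}(k): the birational transformations of P^n defined over k, as
   classes of tuples of homogeneous polynomials of the same degree. *)
Definition bir := {eq_quot bireq_equiv}.
HB.instance Definition _ := Choice.on bir.
HB.instance Definition _ := EqQuotient.on bir.

Lemma birP (f g : birrep) : hsim f g <-> \pi_bir f = \pi_bir g.
Proof. by split=> [h|/eqmodP/asboolP//]; apply/eqmodP/asboolP. Qed.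

Lemma repr_birP (f : birrep) : hsim (repr (\pi_bir f)) f.
Proof. by apply/birP; rewrite reprK. Qed.

Definition comp_rep (f g : birrep) : birrep :=
  mkbir (bir_hcomp (birrepP f) (birrepP g)).
Definition inv_rep (f : birrep) : birrep :=
  mkbir (hinverse_bir (svalP (bir_hinv f))).

(* bir_mul f g is f o g. *)
Definition bir_mul (f g : bir) : bir := \pi_bir (comp_rep (repr f) (repr g)).
Definition bir_one : bir := \pi_bir (mkbir bir_hid).
Definition bir_inv (f : bir) : bir := \pi_bir (inv_rep (repr f)).

Lemma comp_rep_sim (f f' g g' : birrep) : hsim f f' -> hsim g g' ->
  hsim (comp_rep f g) (comp_rep f' g').
Proof.
move=> ff gg; have nz' := bir_hcomp_nz (birrepP f') (birrepP g).
apply: (hsim_trans nz'); first exact: hcomp_siml.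
by apply: hcomp_simr => //; [case: (birrepP f') | exact: birrep_nz..].
Qed.

Lemma bir_mulE (f g : birrep) :
  bir_mul (\pi_bir f) (\pi_bir g) = \pi_bir (comp_rep f g).
Proof. by apply/birP; apply: comp_rep_sim; apply: repr_birP. Qed.

Lemma bir_mulA : associative bir_mul.
Proof.
move=> f g h; rewrite -[f]reprK -[g]reprK -[h]reprK.
rewrite (bir_mulE (repr g)) (bir_mulE (repr f) (repr g)) (bir_mulE (repr f)).
rewrite (bir_mulE _ (repr h)).
by congr (\pi_bir _); apply: val_inj; exact: hcompA.
Qed.

Lemma bir_mul1 : left_id bir_one bir_mul.
Proof.
move=> f; rewrite -[f]reprK bir_mulE.
by congr (\pi_bir _); apply: val_inj; exact: hcomp1l.
Qed.

Lemma bir_mulr1 : right_id bir_one bir_mul.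
Proof.
move=> f; rewrite -[f]reprK bir_mulE.
by congr (\pi_bir _); apply: val_inj; exact: hcomp1r.
Qed.

Lemma bir_mulV : left_inverse bir_one bir_inv bir_mul.
Proof.
move=> f; rewrite -{2}[f]reprK bir_mulE; apply/birP.
by case: (svalP (bir_hinv (repr f))) => _ _ [].
Qed.

Lemma bir_mulrV : right_inverse bir_one bir_inv bir_mul.
Proof.
move=> f; rewrite -{1}[f]reprK bir_mulE; apply/birP.
by case: (svalP (bir_hinv (repr f))) => _ [].
Qed.

HB.instance Definition _ :=
  isGroup.Build bir bir_mulA bir_mul1 bir_mulr1 bir_mulV bir_mulrV.

End Cremona.

Definition normal_subgroup (G : groupType) (N : set G) : Prop :=
  [/\ N 1%g,
      forall x y, N x -> N y -> N (x * y)%g,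
      forall x, N x -> N x^-1%g
    & forall g x, N x -> N (x ^ g)%g].

Definition ev (k K : fieldType) (iota : k -> K) d (x : 'I_d -> K)
  (p : {mpoly k[d]}) : K := mmap iota x p.

(* P is a polynomial in two groups of variables: its coefficients are the
   polynomials in the first group. *)
Definition ev2 (k K : fieldType) (iota : k -> K) d m
    (x : 'I_d -> K) (y : 'I_m -> K) (P : {mpoly {mpoly k[d]}[m]}) : K :=
  mmap (ev iota x) y P.

Section Varieties.
Variables (k : fieldType) (K : closedFieldType) (iota : {rmorphism k -> K}).

(* An algebraic variety over k, K being an algebraic closure of k, given by its
   K-points and a finite atlas of affine charts: chart_coord i identifies the
   subset chart_dom i with the zero locus of eqns i in affine space (the values
   of chart_coord i outside chart_dom i are irrelevant).  It may be reducible. *)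
Record variety := Variety {
  pts :> Type;
  chart : finType;
  adim : chart -> nat;
  eqns : forall i, seq {mpoly k[adim i]};
  chart_dom : chart -> set pts;
  chart_coord : forall i, pts -> {ffun 'I_(adim i) -> K};
  chart_cover : forall p, exists i, chart_dom i p;
  chart_inj : forall i p q, chart_dom i p -> chart_dom i q ->
    chart_coord i p = chart_coord i q -> p = q;
  chart_image : forall i (x : {ffun 'I_(adim i) -> K}),
    (forall P, P \in eqns i -> ev iota x P = 0) <->
    (exists2 p, chart_dom i p & chart_coord i p = x);
  (* The charts overlap along open subsets, with transition maps that are
     locally quotients of polynomials over k. *)
  chart_trans : forall i j p, chart_dom i p -> chart_dom j p ->
    exists (Q : {mpoly k[adim i]}) (P : 'I_(adim j) -> {mpoly k[adim i]}),
      ev iota (chart_coord i p) Q != 0 /\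
      forall q, chart_dom i q -> ev iota (chart_coord i q) Q != 0 ->
        chart_dom j q /\
        forall l, chart_coord j q l =
          ev iota (chart_coord i q) (P l) / ev iota (chart_coord i q) Q;
  (* The diagonal is closed. *)
  chart_sep : forall i j p q, chart_dom i p -> chart_dom j q -> p <> q ->
    exists2 P : {mpoly {mpoly k[adim i]}[adim j]},
      ev2 iota (chart_coord i p) (chart_coord j q) P != 0 &
      forall r, chart_dom i r -> chart_dom j r ->
        ev2 iota (chart_coord i r) (chart_coord j r) P = 0
}.

Definition is_kpoint (A : variety) (p : A) : Prop :=
  exists2 i, chart_dom i p & forall l, exists c, chart_coord i p l = iota c.

Definition kpoints (A : variety) := {p : A | is_kpoint p}.

(* Closedness in the Zariski topology of A(k) is tested on the charts, which
   form an open cover. *)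
Definition closed_kpoints (A : variety) (S : set (kpoints A)) : Prop :=
  forall i, exists E : set {mpoly k[adim i]},
    forall p : kpoints A, chart_dom i (sval p) ->
      (S p <-> forall P, E P -> ev iota (chart_coord i (sval p)) P = 0).

Variable n : nat.

(* P^n(K), as the set of lines in K^{n+1}. *)
Definition proj_space := {L : {vspace 'rV[K]_n.+1} | \dim L == 1%N}.

Definition hcoords (x : proj_space) (v : 'rV[K]_n.+1) : Prop :=
  val x = <[v]>%VS.

(* Openness in A x P^n over K: the basic open subsets of (chart i) x P^n are
   given by the polynomials over K in the affine coordinates on the chart and
   the homogeneous coordinates on P^n, homogeneous in the latter. *)
Definition open_prod (A : variety) (U : A -> set proj_space) : Prop :=
  forall a x i v, U a x -> chart_dom i a -> hcoords x v ->
  exists d (P : {mpoly {mpoly K[adim i]}[n.+1]}), [/\ P \is d.-homog,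
    ev2 idfun (chart_coord i a) (v 0) P != 0 &
    forall b y w, chart_dom i b -> hcoords y w ->
      ev2 idfun (chart_coord i b) (w 0) P != 0 -> U b y].

(* The map (a, x) |-> f a x from U to P^n is regular, and defined over k: at
   each point of U it is given by polynomials over k.  The formula may be
   required wherever F is nonzero, and not only near (a, x): multiplying F by a
   polynomial that vanishes away from (a, x) shrinks the set where it applies. *)
Definition regular_on (A : variety) (U : A -> set proj_space)
    (f : A -> proj_space -> proj_space) : Prop :=
  forall a x i v, U a x -> chart_dom i a -> hcoords x v ->
  exists d (F : 'I_n.+1 -> {mpoly {mpoly k[adim i]}[n.+1]}),
    [/\ forall l, F l \is d.-homog,
        exists l, ev2 iota (chart_coord i a) (v 0) (F l) != 0 &
        forall b y w, chart_dom i b -> hcoords y w -> U b y ->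
          (exists l, ev2 iota (chart_coord i b) (w 0) (F l) != 0) ->
          hcoords (f b y) (\row_l ev2 iota (chart_coord i b) (w 0) (F l))].

(* An A-birational transformation (a, x) |-> (a, f a x) of A x P^n, defined
   over k and inducing an isomorphism U -> V, with inverse
   (a, y) |-> (a, g a y), where U and V surject onto A.  The values of f
   outside U and of g outside V are irrelevant. *)
Record bir_family (A : variety) := BirFamily {
  fam : A -> proj_space -> proj_space;
  fam_inv : A -> proj_space -> proj_space;
  fam_dom : A -> set proj_space;
  fam_codom : A -> set proj_space;
  fam_dom_open : open_prod fam_dom;
  fam_codom_open : open_prod fam_codom;
  fam_dom_surj : forall a, exists x, fam_dom a x;
  fam_codom_surj : forall a, exists y, fam_codom a y;
  famP : forall a x, fam_dom a x ->
    fam_codom a (fam a x) /\ fam_inv a (fam a x) = x;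
  fam_invP : forall a y, fam_codom a y ->
    fam_dom a (fam_inv a y) /\ fam a (fam_inv a y) = y;
  fam_regular : regular_on fam_dom fam;
  fam_inv_regular : regular_on fam_codom fam_inv
}.

(* phi is the birational transformation f_a : x |-> f a x. *)
Definition specializes (A : variety) (f : bir_family A) (a : A)
    (phi : bir k n) : Prop :=
  exists2 F : birrep k n, phi = \pi_(bir k n) F &
    forall x v, fam_dom f a x -> hcoords x v ->
      (exists l, ev iota (v 0) (tnth (birval F) l) != 0) ->
      hcoords (fam f a x) (\row_l ev iota (v 0) (tnth (birval F) l)).

(* The map A(k) -> Bir_{P^n}(k) given by a k-morphism A -> Bir_{P^n}. *)
Definition is_morphism (A : variety) (rho : kpoints A -> bir k n) : Prop :=
  exists f : bir_family A, forall a, specializes f (sval a) (rho a).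

Definition zariski_closed (N : set (bir k n)) : Prop :=
  forall (A : variety) (rho : kpoints A -> bir k n),
    is_morphism rho -> closed_kpoints (rho @^-1` N)%classic.

End Varieties.

(* Main.v *)
From HB Require Import structures.
Require Import Defs.
From mathcomp Require Import all_boot all_order perm all_algebra.
From mathcomp Require Import generic_quotient finmap mpoly.
From mathcomp Require Import boolp classical_sets cardinality.
Set Implicit Arguments.
Unset Strict Implicit.
Unset Printing Implicit Defensive.
Import GRing.Theory.
Local Open Scope ring_scope.
Local Open Scope quotient_scope.

(** The proof rests on one degeneration.  Let [h] be a birational map that is a
    local isomorphism at the point [1 : 0 : ... : 0] and fixes it.  Conjugating
    [h] by the homotheties [[x_0 : t x_1 : ... : t x_n]] gives a morphism from
    the punctured affine line to Bir, which extends to [t = 0]; its value there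
    is a linear map, the differential of [h] at the fixed point
    ([contraction_family]).  A closed set that contains the members of a family
    for a dense set of parameters contains all of them
    ([closed_pointed_family]), so closed normal subgroups are stable under such
    limits.

    Let [N] be closed and normal, and let [f] in [N] be nontrivial.  As the
    field is infinite, [f] is a local isomorphism at some rational point [p]
    with image [q] distinct from [p].  Take the commutator of [f] with a
    dilatation of ratio [s] centred at [q] that fixes [p].  It lies in [N] and
    fixes [p], and its limit at [p] is linear and explicit: the quotient of the
    dilatations of ratio [s] centred at [q] and at [p], because a dilatation
    acts as a scalar on the tangent space at its centre
    ([commutator_limit]).  Hence, modulo [N], the dilatations of ratio [s]
    centred at the coordinate points agree; their product is a scalar matrix,
    so the dilatations of ratio [s ^ (n + 1)] belong to [N].  These ratios are
    dense in the multiplicative group, over which the dilatations form a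
    family, so all dilatations belong to [N] ([lin_dil_all]).  They generate
    the linear group ([unitmx_dilatations]), which is therefore contained in
    [N].

    Finally, let [f] be arbitrary.  Up to linear maps it is a local isomorphism
    [h] fixing the base point.  Its conjugates by homotheties are equal to [h]
    modulo [N], and they degenerate to a linear map, which is in [N]; passing
    to the limit in [h^-1 h^t] shows that [h] is in [N] ([normal_full]).

    Families are handled through representatives whose coefficients are
    polynomials in the parameters.  A pair of inverse maps that fix the base
    point with multipliers that vanish nowhere ([local_iso]) specialises to a
    birational map at every parameter, since the base point lies in the domain
    of each member; such pairs are stable under composition and inversion. *)

(** * Identities in groups *)

Section GroupIdentities.
Variable G : groupType.
Implicit Types (x y z a b g : G).
Local Open Scope group_scope.

Lemma conj_commutator x y a b : x * b = a * x ->
  y^-1 * b^-1 * y * a = (x * y)^-1 * (x * y) ^ a.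
Proof.
move=> e; have -> : b = x^-1 * (a * x) by rewrite -e mulKg.
by rewrite /conjg !invgM invgK !mulgA.
Qed.

Lemma commute_cancel x a b : x * b = b * x -> x^-1 * b^-1 * x * a = b^-1 * a.
Proof.
move=> e; have bx : b ^ x = b by rewrite /conjg -e mulKg.
by rewrite -[in RHS]bx -conjVg /conjg !mulgA.
Qed.

Lemma conj_fixed x a b g : a ^ g = a -> b ^ g = b ->
  (x ^ g)^-1 * b^-1 * x ^ g * a = (x^-1 * b^-1 * x * a) ^ g.
Proof. by move=> ea eb; rewrite !conjMg !conjVg ea eb. Qed.

Lemma conj_ratio a b a' b' g : a ^ g = a' -> b ^ g = b' ->
  (a^-1 * b) ^ g = a'^-1 * b'.
Proof. by rewrite conjMg conjVg => -> ->. Qed.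

Lemma ratio_step x y z a :
  (z^-1 * x^-1) * (y * a) = (x^-1 * y) ^ z * (z^-1 * a).
Proof. by rewrite /conjg !mulgA mulgK. Qed.

Lemma commutator_conj x g : x^-1 * x ^ g = (g^-1) ^ x * g.
Proof. by rewrite /conjg !mulgA. Qed.

Lemma commute_conj a g : a * g = g * a -> a ^ g = a.
Proof. by move=> e; rewrite /conjg e mulKg. Qed.

End GroupIdentities.

(** * Evaluation and substitution of homogeneous polynomials *)

Section Mmap.
Variables (R S T : nzRingType) (m : nat).

Lemma eq_mmap (f f' : R -> S) (h h' : 'I_m -> S) (p : {mpoly R[m]}) :
  f =1 f' -> h =1 h' -> mmap f h p = mmap f' h' p.
Proof.
move=> ef eh; rewrite /mmap; apply: eq_bigr => u _.
by rewrite ef (mmap1_eq _ eh).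
Qed.

Lemma rmorph_mmap (phi : {rmorphism S -> T}) (f : R -> S) (h : 'I_m -> S)
    (p : {mpoly R[m]}) :
  phi (mmap f h p) = mmap (phi \o f) (phi \o h) p.
Proof.
rewrite /mmap rmorph_sum; apply: eq_bigr => u _.
rewrite rmorphM /mmap1 rmorph_prod; congr (_ * _).
by apply: eq_bigr => i _; rewrite rmorphXn.
Qed.

End Mmap.

Lemma homog_mmap (R : nzRingType) (S : comNzRingType) m
    (f : {rmorphism R -> S}) (h : 'I_m -> S) (c : S) d (p : {mpoly R[m]}) :
  p \is d.-homog -> mmap f (fun i => c * h i) p = c ^+ d * mmap f h p.
Proof.
move=> /dhomogP hp; rewrite /mmap mulr_sumr big_seq [RHS]big_seq.
apply: eq_bigr => u /hp <-; rewrite mulrCA; congr (_ * _); rewrite /mmap1.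
under eq_bigr do rewrite exprMn.
by rewrite big_split /= prodrXr -mdegE.
Qed.

Lemma mmap_map (R S : nzRingType) (T : comNzRingType) m
    (g : {rmorphism R -> S}) (f : {rmorphism S -> T}) (h : 'I_m -> T)
    (p : {mpoly R[m]}) :
  mmap f h (map_mpoly g p) = mmap (f \o g) h p.
Proof.
rewrite /map_mpoly [LHS](rmorph_mmap (mmap f h)); apply: eq_mmap => [c|i] /=.
  by rewrite mmapC.
by rewrite mmapX mmap1U.
Qed.

Lemma mmap_comp (R S : comNzRingType) m l (f : {rmorphism R -> S})
    (h : 'I_l -> S) (p : {mpoly R[m]}) (F : m.-tuple {mpoly R[l]}) :
  mmap f h (p \mPo F) = mmap f (fun i => mmap f h (tnth F i)) p.
Proof.
rewrite /comp_mpoly [LHS](rmorph_mmap (mmap f h)); apply: eq_mmap => [c|i] //=.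
exact: mmapC.
Qed.

Lemma mmapXU (R : nzRingType) (S : comNzRingType) m (f : {rmorphism R -> S})
    (h : 'I_m -> S) i : mmap f h 'X_i = h i.
Proof. by rewrite mmapX mmap1U. Qed.

Lemma map_mpolyXU (R S : nzRingType) m (f : {rmorphism R -> S}) (i : 'I_m) :
  map_mpoly f 'X_i = 'X_i.
Proof. exact: map_mpolyX. Qed.

Lemma map_comp_mpoly (R S : comNzRingType) m l (f : {rmorphism R -> S})
    (p : {mpoly R[m]}) (F : m.-tuple {mpoly R[l]}) :
  map_mpoly f (p \mPo F) =
  map_mpoly f p \mPo [tuple map_mpoly f (tnth F i) | i < m].
Proof.
rewrite {2}/comp_mpoly mmap_map /comp_mpoly rmorph_mmap.
by apply: eq_mmap => [c|i] /=; rewrite ?map_mpolyC ?tnth_mktuple.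
Qed.

Lemma map_dhomog (R S : nzRingType) m (f : {rmorphism R -> S}) d
    (p : {mpoly R[m]}) : p \is d.-homog -> map_mpoly f p \is d.-homog.
Proof.
move=> /dhomogP hp; apply/dhomogP => u.
rewrite mcoeff_msupp mcoeff_map_mpoly => nz; apply: hp; rewrite mcoeff_msupp.
by apply: contraNneq nz => ->; rewrite raddf0.
Qed.

Lemma comp_dhomog (R : comNzRingType) m l d e (p : {mpoly R[m]})
    (F : m.-tuple {mpoly R[l]}) :
  p \is d.-homog -> (forall i, tnth F i \is e.-homog) ->
  p \mPo F \is (e * d)%N.-homog.
Proof.
move=> /dhomogP hp hF; rewrite comp_mpolyE big_seq.
apply: rpred_sum => u /hp du.
have <- : mdeg u = d := du; rewrite mdegE big_distrr /=; apply: rpredZ.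
elim/big_ind2: _ => //=; first exact: dhomog1.
  by move=> p1 d1 p2 d2; apply: dhomogM.
by move=> i _; apply: dhomogMn.
Qed.

(** * Birational maps of projective space that are local isomorphisms at a
      fixed point *)

(** Proportionality by cross-multiplication, which leaves the common factor
    implicit. *)
Definition collinear (S : comNzRingType) m (u v : 'I_m -> S) : Prop :=
  forall i j, u i * v j = u j * v i.

Definition compose (R : comNzRingType) m l r (F : m.-tuple {mpoly R[l]})
    (G : l.-tuple {mpoly R[r]}) : m.-tuple {mpoly R[r]} :=
  [tuple tnth F i \mPo G | i < m].

Lemma composeE (R : comNzRingType) m l r (F : m.-tuple {mpoly R[l]})
    (G : l.-tuple {mpoly R[r]}) i : tnth (compose F G) i = tnth F i \mPo G.
Proof. exact: tnth_mktuple. Qed.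

Lemma homog_comp_scale (R : comNzRingType) m l d (p : {mpoly R[m]})
    (F G : m.-tuple {mpoly R[l]}) c :
  p \is d.-homog -> (forall i, tnth F i = c * tnth G i) ->
  p \mPo F = c ^+ d * (p \mPo G).
Proof.
move=> hp FG; rewrite -[RHS](homog_mmap _ _ _ hp).
exact: eq_mmap.
Qed.

Definition map_tuple_mpoly (R S : nzRingType) (f : R -> S) m l
    (F : m.-tuple {mpoly R[l]}) : m.-tuple {mpoly S[l]} :=
  [tuple map_mpoly f (tnth F i) | i < m].

Lemma composeA (R : comNzRingType) m l r s (F : m.-tuple {mpoly R[l]})
    (G : l.-tuple {mpoly R[r]}) (H : r.-tuple {mpoly R[s]}) :
  compose F (compose G H) = compose (compose F G) H.
Proof.
apply: eq_from_tnth => i; rewrite !tnth_mktuple.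
rewrite [RHS](mmap_comp (@mpolyC s R)).
by apply: eq_mmap => // j; rewrite tnth_mktuple.
Qed.

Lemma map_compose (R S : comNzRingType) (f : {rmorphism R -> S}) m l r
    (F : m.-tuple {mpoly R[l]}) (G : l.-tuple {mpoly R[r]}) :
  map_tuple_mpoly f (compose F G) =
  compose (map_tuple_mpoly f F) (map_tuple_mpoly f G).
Proof. by apply: eq_from_tnth => i; rewrite !tnth_mktuple map_comp_mpoly. Qed.

Section LocalIso.
Variable n : nat.

Definition basept (R : nzRingType) (i : 'I_n.+1) : R := (i == 0)%:R.

(** [F] and [G] define mutually inverse maps over [R] that fix the point
    [1 : 0 : ... : 0], with multipliers [a] and [b].  They specialise to
    birational maps under every morphism from [R] to a field that kills neither
    [a] nor [b]: the base point then witnesses that no composite vanishes. *)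
Record local_iso (R : comNzRingType) (F G : n.+1.-tuple {mpoly R[n.+1]})
    (a b : R) : Prop := LocalIso {
  li_homog : exists d, forall i, tnth F i \is d.-homog;
  li_inv_homog : exists d, forall i, tnth G i \is d.-homog;
  li_invK : collinear (tnth (compose G F)) (fun i => 'X_i);
  li_K : collinear (tnth (compose F G)) (fun i => 'X_i);
  li_base : forall i, meval (basept R) (tnth F i) = a * basept R i;
  li_inv_base : forall i, meval (basept R) (tnth G i) = b * basept R i
}.

Lemma local_iso_sym (R : comNzRingType) F G (a b : R) :
  local_iso F G a b -> local_iso G F b a.
Proof. by case=> *; split. Qed.

Lemma meval_map (R S : comNzRingType) (f : {rmorphism R -> S})
    (p : {mpoly R[n.+1]}) (v : 'I_n.+1 -> R) :
  meval (f \o v) (map_mpoly f p) = f (meval v p).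
Proof. by rewrite /meval mmap_map rmorph_mmap. Qed.

Lemma meval_map_base (R S : comNzRingType) (f : {rmorphism R -> S})
    (p : {mpoly R[n.+1]}) :
  meval (basept S) (map_mpoly f p) = f (meval (basept R) p).
Proof.
rewrite -meval_map; apply: meval_eq => i.
by rewrite /= /basept; case: eqP; rewrite ?rmorph1 ?rmorph0.
Qed.

Lemma map_base (R S : comNzRingType) (f : {rmorphism R -> S}) a i :
  f (a * basept R i) = f a * basept S i.
Proof. by rewrite rmorphM /basept; case: eqP; rewrite ?rmorph1 ?rmorph0. Qed.

Lemma map_local_iso (R S : comNzRingType) (f : {rmorphism R -> S}) F G a b :
  local_iso F G a b ->
  local_iso (map_tuple_mpoly f F) (map_tuple_mpoly f G) (f a) (f b).
Proof.
have inv H H' : collinear (tnth (compose H H')) (fun i => 'X_i) ->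
    collinear (tnth (compose (map_tuple_mpoly f H) (map_tuple_mpoly f H')))
      (fun i => 'X_i).
  move=> c i j; rewrite -map_compose !tnth_mktuple.
  rewrite -!(map_mpolyXU f) -[LHS]rmorphM -[RHS]rmorphM.
  by have := c i j; rewrite !tnth_mktuple => ->.
case=> [[d hF] [e hG] GF FG bF bG]; split.
- by exists d => i; rewrite tnth_mktuple map_dhomog.
- by exists e => i; rewrite tnth_mktuple map_dhomog.
- exact: inv.
- exact: inv.
- by move=> i; rewrite tnth_mktuple meval_map_base bF map_base.
- by move=> i; rewrite tnth_mktuple meval_map_base bG map_base.
Qed.

Lemma base_comp (R : comNzRingType) d (F G : n.+1.-tuple {mpoly R[n.+1]}) a b :
  (forall i, tnth F i \is d.-homog) ->
  (forall i, meval (basept R) (tnth F i) = a * basept R i) ->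
  (forall i, meval (basept R) (tnth G i) = b * basept R i) ->
  forall i, meval (basept R) (tnth (compose F G) i) = b ^+ d * a * basept R i.
Proof.
move=> hF bF bG i; rewrite tnth_mktuple /meval mmap_comp.
rewrite (eq_mmap _ (f' := idfun) (h' := fun j => b * basept R j)) //.
by rewrite (homog_mmap _ _ _ (hF i)) -/(meval _ _) bF mulrA.
Qed.

(** [G1 F1] is the identity up to a factor, which passes through the homogeneous
    map [G2]; the component [F2_0] serves to write that factor as a quotient. *)
Lemma inverse_comp (R : idomainType) d
    (F1 G1 F2 G2 : n.+1.-tuple {mpoly R[n.+1]}) :
  (forall i, tnth G2 i \is d.-homog) ->
  collinear (tnth (compose G1 F1)) (fun i => 'X_i) ->
  collinear (tnth (compose G2 F2)) (fun i => 'X_i) ->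
  tnth F2 ord0 != 0 ->
  collinear (tnth (compose (compose G2 G1) (compose F1 F2))) (fun i => 'X_i).
Proof.
move=> hG2 inv1 inv2 nz.
pose Q := compose (compose G1 F1) F2.
have QF i j : tnth Q i * tnth F2 j = tnth Q j * tnth F2 i.
  have XF l : tnth F2 l = 'X_l \mPo F2 by rewrite comp_mpolyXU (tnth_nth 0).
  rewrite 2!(composeE (compose G1 F1)) (XF i) (XF j).
  by rewrite -[LHS]rmorphM -[RHS]rmorphM inv1.
have eqc : compose (compose G2 G1) (compose F1 F2) = compose G2 Q.
  by rewrite -composeA (composeA G1) composeA -(composeA G2).
clearbody Q; pose T := [tuple tnth F2 ord0 * tnth Q i | i < n.+1].
have key i : tnth F2 ord0 ^+ d * tnth (compose G2 Q) i =
    tnth Q ord0 ^+ d * tnth (compose G2 F2) i.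
  rewrite !composeE -(homog_comp_scale (F := T) (hG2 i)); last first.
    by move=> j; exact: tnth_mktuple.
  apply: (homog_comp_scale (hG2 i)) => j.
  by rewrite (QF ord0) [RHS]mulrC; apply: tnth_mktuple.
move=> i j; rewrite eqc; apply: (mulfI (expf_neq0 d nz)).
by rewrite !mulrA !key -!mulrA inv2.
Qed.

Lemma base_neq0 (R : comNzRingType) (F : n.+1.-tuple {mpoly R[n.+1]}) a :
  (forall i, meval (basept R) (tnth F i) = a * basept R i) ->
  a != 0 -> tnth F ord0 != 0.
Proof.
move=> bF; apply: contraNneq => F0; have := bF ord0.
by rewrite F0 meval0 /basept eqxx mulr1 => <-.
Qed.

Lemma comp_local_iso (R : idomainType) F1 G1 F2 G2 (a1 b1 a2 b2 : R) :
  local_iso F1 G1 a1 b1 -> local_iso F2 G2 a2 b2 -> b1 != 0 -> a2 != 0 ->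
  exists d e, local_iso (compose F1 F2) (compose G2 G1)
    (a2 ^+ d * a1) (b1 ^+ e * b2).
Proof.
case=> [[d1 hF1] [e1 hG1] GF1 FG1 bF1 bG1].
case=> [[d2 hF2] [e2 hG2] GF2 FG2 bF2 bG2] nzb nza.
exists d1, e2; split.
- by exists (d2 * d1)%N => i; rewrite tnth_mktuple comp_dhomog.
- by exists (e1 * e2)%N => i; rewrite tnth_mktuple comp_dhomog.
- exact: (inverse_comp hG2 GF1 GF2 (base_neq0 bF2 nza)).
- exact: (inverse_comp hF1 FG2 FG1 (base_neq0 bG1 nzb)).
- exact: (base_comp hF1).
- exact: (base_comp hG2).
Qed.

End LocalIso.

(** * Families of birational maps over affine varieties *)

HB.instance Definition _ (k K : fieldType) (iota : {rmorphism k -> K}) d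
    (x : 'I_d -> K) :=
  GRing.RMorphism.copy (ev iota x) (mmap iota x).

Section Evaluation.
Variables (k K : fieldType) (iota : {rmorphism k -> K}) (d m : nat).
Implicit Types (x : 'I_d -> K) (y : 'I_m -> K).

Lemma evX x i : ev iota x 'X_i = x i.
Proof. exact: mmapXU. Qed.

Lemma ev2X x y i : ev2 iota x y 'X_i = y i.
Proof. exact: (mmapXU (ev iota x)). Qed.

Lemma ev2C x y p : ev2 iota x y p%:MP = ev iota x p.
Proof. exact: (mmapC y (ev iota x)). Qed.

End Evaluation.

HB.instance Definition _ (k K : fieldType) (iota : {rmorphism k -> K}) d m
    (x : 'I_d -> K) (y : 'I_m -> K) :=
  GRing.RMorphism.copy (ev2 iota x y) (mmap (ev iota x) y).

Section AffineVariety.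
Variables (k : fieldType) (K : closedFieldType) (iota : {rmorphism k -> K}).
Variables (m : nat) (E : seq {mpoly k[m]}).

Definition zeros := {z : {ffun 'I_m -> K} | all (fun P => ev iota z P == 0) E}.

Let coord (_ : unit) (p : zeros) : {ffun 'I_m -> K} := val p.

Let coord_inj i p q : True -> True -> coord i p = coord i q -> p = q.
Proof. by move=> _ _; apply: val_inj. Qed.

Let coord_image (i : unit) (x : {ffun 'I_m -> K}) :
  (forall P, P \in E -> ev iota x P = 0) <->
  (exists2 p : zeros, True & coord i p = x).
Proof.
split=> [h|[[z hz] _ <-] P PE]; last by rewrite /=; apply/eqP/(allP hz).
have hx : all (fun P => ev iota x P == 0) E by apply/allP => P /h ->.
by exists (exist _ x hx).
Qed.

Let coord_trans (i j : unit) (p : zeros) : True -> True ->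
  exists (Q : {mpoly k[m]}) (P : 'I_m -> {mpoly k[m]}),
    ev iota (coord i p) Q != 0 /\
    forall q, True -> ev iota (coord i q) Q != 0 -> True /\
      forall l, coord j q l = ev iota (coord i q) (P l) / ev iota (coord i q) Q.
Proof.
move=> _ _; exists 1, (fun l => 'X_l); rewrite rmorph1 oner_eq0; split=> //.
move=> q _ _; split=> // l; rewrite rmorph1 divr1 evX.
by case: i j => -[].
Qed.

Let coord_sep (i j : unit) (p q : zeros) : True -> True -> p <> q ->
  exists2 P : {mpoly {mpoly k[m]}[m]},
    ev2 iota (coord i p) (coord j q) P != 0 &
    forall r, True -> True -> ev2 iota (coord i r) (coord j r) P = 0.
Proof.
move=> _ _ pq; have [l ne] : exists l, coord i p l <> coord j q l.
  apply: contra_notP pq => h; apply/val_inj/ffunP => l.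
  by apply: contra_notP h => ne; exists l.
case: i j ne => -[] ne.
exists (('X_l)%:MP - 'X_l : {mpoly {mpoly k[m]}[m]}) => [|r _ _].
  by rewrite rmorphB /= ev2C ev2X evX subr_eq0; apply/eqP.
by rewrite rmorphB /= ev2C ev2X evX subrr.
Qed.

Definition affine_variety : variety iota :=
  @Variety k K iota zeros unit (fun=> m) (fun=> E) (fun _ _ => True) coord
    (fun=> ex_intro _ tt I) coord_inj coord_image coord_trans coord_sep.

End AffineVariety.

Section EvalTuple.
Variables (K : fieldType) (n : nat).
Notation ptup := (n.+1.-tuple {mpoly K[n.+1]}).
Implicit Types (F G : ptup) (v : 'rV[K]_n.+1).

Definition eval_tuple F v : 'rV[K]_n.+1 := \row_l meval (v 0) (tnth F l).

Lemma eval_tuple_eq0 F v :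
  (eval_tuple F v != 0) <-> (exists l, meval (v 0) (tnth F l) != 0).
Proof.
split=> [nz|[l nz]]; last first.
  by apply: contraNneq nz => /rowP/(_ l); rewrite !mxE => ->.
apply: contra_neqP nz => h; apply/rowP => l; rewrite !mxE.
by apply: contra_notP h => /eqP; exists l.
Qed.

Lemma eval_tupleZ F d c v : (forall i, tnth F i \is d.-homog) ->
  eval_tuple F (c *: v) = c ^+ d *: eval_tuple F v.
Proof.
move=> hF; apply/rowP => l; rewrite !mxE -(homog_mmap _ _ _ (hF l)).
by apply: meval_eq => i; rewrite mxE.
Qed.

Lemma eval_compose F G v :
  eval_tuple (compose F G) v = eval_tuple F (eval_tuple G v).
Proof.
apply/rowP => l; rewrite !mxE composeE comp_mpoly_meval.
by apply: meval_eq => i; rewrite mxE.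
Qed.

Lemma eval_inverse F G v : v != 0 ->
  collinear (tnth (compose G F)) (fun i => 'X_i) ->
  eval_tuple G (eval_tuple F v) != 0 ->
  exists2 c, c != 0 & eval_tuple G (eval_tuple F v) = c *: v.
Proof.
rewrite -eval_compose => /rV0Pn[l nzl] inv nz.
have cross i : eval_tuple (compose G F) v 0 i * v 0 l =
    eval_tuple (compose G F) v 0 l * v 0 i.
  rewrite !mxE -(mevalXU (v 0) i) -(mevalXU (v 0) l).
  by rewrite -[LHS]rmorphM -[RHS]rmorphM inv.
move: (eval_tuple (compose G F) v) nz cross => w nz cross.
have wE : w = (w 0 l / v 0 l) *: v.
  apply/rowP => i; rewrite mxE; apply: (mulIf nzl).
  by rewrite cross mulrAC divfK.
exists (w 0 l / v 0 l) => //.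
by apply: contraNneq nz => c0; rewrite wE c0 scale0r.
Qed.

End EvalTuple.

Section ProjAction.
Variables (K : closedFieldType) (n : nat).
Implicit Types (F G : n.+1.-tuple {mpoly K[n.+1]}) (v w : 'rV[K]_n.+1).
Implicit Types (x : proj_space K n).

Lemma hcoords_neq0 x v : hcoords x v -> v != 0.
Proof.
by move=> xv; have := valP x; rewrite /= xv dim_vline; case: (v != 0).
Qed.

Lemma hcoordsZ x v w : hcoords x v -> hcoords x w ->
  exists2 c, c != 0 & w = c *: v.
Proof.
move=> xv xw; have /vlineP[c wE] : w \in <[v]>%VS by rewrite -xv xw memv_line.
exists c => //; apply: contraNneq (hcoords_neq0 xw) => c0.
by rewrite wE c0 scale0r.
Qed.

Lemma hcoords_scale x v c : c != 0 -> hcoords x v -> hcoords x (c *: v).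
Proof.
move=> nz; rewrite /hcoords => ->; apply/eqP; rewrite eqEsubv -!memvE.
rewrite [X in _ && X]rpredZ ?memv_line // andbT.
by apply/vlineP; exists c^-1; rewrite scalerA mulVf ?scale1r.
Qed.

Lemma hcoords_inj x y v : hcoords x v -> hcoords y v -> x = y.
Proof. by move=> xv yv; apply: val_inj; rewrite xv yv. Qed.

Lemma hcoords_vpick x : hcoords x (vpick (val x)).
Proof.
apply/eqP; rewrite eq_sym eqEdim -memvE memv_pick dim_vline vpick0 -dimv_eq0.
by have /eqP-> := valP x.
Qed.

Lemma line_ex v : v != 0 -> exists x, hcoords x v.
Proof.
move=> nz; have hv : \dim <[v]>%VS == 1%N by rewrite dim_vline nz.
by exists (exist _ <[v]>%VS hv).
Qed.

(** The value of the rational map [F] at the point [x], or [x] itself where the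
    components of [F] vanish. *)
Definition act F x : proj_space K n :=
  insubd x <[eval_tuple F (vpick (val x))]>%VS.

Lemma hcoords_act F d x v : (forall i, tnth F i \is d.-homog) ->
  hcoords x v -> eval_tuple F v != 0 -> hcoords (act F x) (eval_tuple F v).
Proof.
move=> hF xv nz; have [c nzc vE] := hcoordsZ (hcoords_vpick x) xv.
have nzp : eval_tuple F (vpick (val x)) != 0.
  apply: contraNneq nz => e0.
  by rewrite vE (eval_tupleZ _ _ hF) e0 scaler0.
rewrite vE (eval_tupleZ _ _ hF); apply: hcoords_scale.
  exact: expf_neq0.
by rewrite /hcoords /act val_insubd dim_vline nzp.
Qed.

(** When [F] and [G] are inverse to each other, [F] maps this open set
    isomorphically onto [inv_dom G F]. *)
Definition inv_dom F G x : Prop := exists v,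
  [/\ hcoords x v, eval_tuple F v != 0 & eval_tuple G (eval_tuple F v) != 0].

Lemma inv_domE F G d e x v : (forall i, tnth F i \is d.-homog) ->
  (forall i, tnth G i \is e.-homog) -> hcoords x v ->
  inv_dom F G x <->
  eval_tuple F v != 0 /\ eval_tuple G (eval_tuple F v) != 0.
Proof.
move=> hF hG xv; split=> [[w [xw]]|[h1 h2]]; last by exists v.
have [c nzc ->] := hcoordsZ xv xw.
rewrite (eval_tupleZ _ _ hF) (eval_tupleZ _ _ hG) !scaler_eq0 !expf_eq0.
by rewrite (negPf nzc) !andbF.
Qed.

Lemma inv_domP F G a b x : local_iso F G a b -> inv_dom F G x ->
  inv_dom G F (act F x) /\ act G (act F x) = x.
Proof.
case=> [[d hF] [e hG] GF FG _ _] [v [xv nF nGF]].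
have aF := hcoords_act hF xv nF.
have [c nzc cE] := eval_inverse (hcoords_neq0 xv) GF nGF.
split; last first.
  apply: (hcoords_inj (hcoords_act hG aF nGF)).
  by rewrite cE; apply: hcoords_scale.
exists (eval_tuple F v); split=> //.
by rewrite cE (eval_tupleZ _ _ hF) scaler_eq0 negb_or expf_neq0.
Qed.

Lemma inv_dom_base F G a b : local_iso F G a b -> a != 0 -> b != 0 ->
  exists x, inv_dom F G x.
Proof.
case=> [[d hF] [e hG] GF FG bF bG] nza nzb.
pose v : 'rV[K]_n.+1 := \row_i basept K i.
have base H c : (forall i, meval (basept K) (tnth H i) = c * basept K i) ->
    eval_tuple H v = c *: v.
  move=> bH; apply/rowP => i; rewrite !mxE -bH; apply: meval_eq => j.
  by rewrite mxE.
have nzv : v != 0.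
  by apply/rV0Pn; exists 0; rewrite mxE /basept eqxx oner_eq0.
have [x xv] := line_ex nzv; exists x, v.
rewrite (base F a bF) (eval_tupleZ _ _ hG) (base G b bG) !scaler_eq0.
by rewrite (negPf nza) (negPf nzb) (negPf nzv) expf_eq0 (negPf nza) andbF.
Qed.

End ProjAction.

Section Family.
Variables (k : fieldType) (K : closedFieldType) (iota : {rmorphism k -> K}).
Variables (m : nat) (E : seq {mpoly k[m]}) (n : nat).
Notation A := (affine_variety iota E).
Notation ptup := (n.+1.-tuple {mpoly {mpoly k[m]}[n.+1]}).
Implicit Types (F G : ptup) (z : A).

Definition coordA z : 'I_m -> K := sval z.

Definition fiber F z := map_tuple_mpoly (ev iota (coordA z)) F.

Lemma ev2_fiber F z (v : 'rV[K]_n.+1) l :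
  ev2 iota (coordA z) (v 0) (tnth F l) = meval (v 0) (tnth (fiber F z) l).
Proof. by rewrite tnth_mktuple /meval (mmap_map (ev iota (coordA z))). Qed.

Lemma row_ev2_fiber F z (v : 'rV[K]_n.+1) :
  \row_l ev2 iota (coordA z) (v 0) (tnth F l) = eval_tuple (fiber F z) v.
Proof. by apply/rowP => l; rewrite !mxE ev2_fiber. Qed.

Lemma fiber_homog F d z : (forall i, tnth F i \is d.-homog) ->
  forall i, tnth (fiber F z) i \is d.-homog.
Proof. by move=> hF i; rewrite tnth_mktuple map_dhomog. Qed.

Lemma fiber_compose F G z :
  fiber (compose F G) z = compose (fiber F z) (fiber G z).
Proof. exact: map_compose. Qed.

Lemma ev2_lift z (v : 'rV[K]_n.+1) (p : {mpoly {mpoly k[m]}[n.+1]}) :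
  ev2 idfun (coordA z) (v 0) (map_mpoly (map_mpoly iota) p) =
  ev2 iota (coordA z) (v 0) p.
Proof.
rewrite /ev2 (mmap_map (map_mpoly iota) (ev idfun (coordA z))).
by apply: eq_mmap => // c /=; rewrite /ev mmap_map.
Qed.

Section BirFamily.
Variables (F G : ptup) (a b : {mpoly k[m]}).
Hypothesis FG : local_iso F G a b.
Hypothesis nz :
  forall z, ev iota (coordA z) a != 0 /\ ev iota (coordA z) b != 0.

Lemma family_dom_open :
  open_prod (fun z : A => inv_dom (fiber F z) (fiber G z)).
Proof.
move=> z x i v Ux _ xv; case: FG => [[d hF] [e hG] _ _ _ _].
have [nF nGF] := (inv_domE (fiber_homog z hF) (fiber_homog z hG) xv).1 Ux.
have [j nj] := (eval_tuple_eq0 _ _).1 nF.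
rewrite -eval_compose -fiber_compose in nGF.
have [l nl] := (eval_tuple_eq0 _ _).1 nGF.
exists (d + d * e)%N.
exists (map_mpoly (map_mpoly iota) (tnth F j * tnth (compose G F) l)).
have evP b' (w : 'rV[K]_n.+1) :
    ev2 idfun (chart_coord i b') (w 0)
      (map_mpoly (map_mpoly iota) (tnth F j * tnth (compose G F) l)) =
    meval (w 0) (tnth (fiber F b') j) *
    meval (w 0) (tnth (fiber (compose G F) b') l).
  by rewrite (ev2_lift b' w) rmorphM /= !ev2_fiber.
split.
- by apply/map_dhomog/dhomogM => //; rewrite composeE comp_dhomog.
- by rewrite evP mulf_neq0.
move=> b' y w _ yw; rewrite evP mulf_eq0 negb_or => /andP[n1 n2].
apply/(inv_domE (fiber_homog b' hF) (fiber_homog b' hG) yw).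
rewrite -eval_compose -fiber_compose.
by split; apply/eval_tuple_eq0; [exists j | exists l].
Qed.

Lemma family_regular :
  regular_on (fun z : A => inv_dom (fiber F z) (fiber G z))
    (fun z => act (fiber F z)).
Proof.
move=> z x i v Ux _ xv; case: FG => [[d hF] [e hG] _ _ _ _].
exists d, (tnth F); split=> //.
  have [nF _] := (inv_domE (fiber_homog z hF) (fiber_homog z hG) xv).1 Ux.
  have [l nl] := (eval_tuple_eq0 _ _).1 nF.
  by exists l; rewrite (ev2_fiber F z).
move=> b' y w _ yw _ [l nl]; rewrite (row_ev2_fiber F b').
apply: (hcoords_act (fiber_homog b' hF) yw); apply/eval_tuple_eq0.
by exists l; rewrite -ev2_fiber.
Qed.

(** The domain meets every fibre because it contains the base point. *)
Lemma family_dom_surj z : exists x, inv_dom (fiber F z) (fiber G z) x.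
Proof.
have [nza nzb] := nz z.
exact: (inv_dom_base (map_local_iso (ev iota (coordA z)) FG)).
Qed.

Lemma familyP z x : inv_dom (fiber F z) (fiber G z) x ->
  inv_dom (fiber G z) (fiber F z) (act (fiber F z) x) /\
  act (fiber G z) (act (fiber F z) x) = x.
Proof. exact: (inv_domP (map_local_iso (ev iota (coordA z)) FG)). Qed.

End BirFamily.

Definition local_iso_family F G a b (FG : local_iso F G a b)
    (nz : forall z, ev iota (coordA z) a != 0 /\ ev iota (coordA z) b != 0) :
    bir_family n A :=
  let GF := local_iso_sym FG in
  let nz' z := conj (nz z).2 (nz z).1 in
  @BirFamily k K iota n A (fun z => act (fiber F z)) (fun z => act (fiber G z))
    _ _ (family_dom_open FG) (family_dom_open GF)
    (family_dom_surj FG nz) (family_dom_surj GF nz')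
    (familyP FG) (familyP GF) (family_regular FG) (family_regular GF).

Definition represents (f : bir k n) (F : ptuple k n) : Prop :=
  exists2 B : birrep k n, f = \pi_(bir k n) B & birval B = F.

Lemma local_iso_morphism F G a b (rho : kpoints A -> bir k n) :
  local_iso F G a b ->
  (forall z, ev iota (coordA z) a != 0 /\ ev iota (coordA z) b != 0) ->
  (forall (p : kpoints A) (c : 'I_m -> k),
     (forall l, coordA (sval p) l = iota (c l)) ->
     represents (rho p) (map_tuple_mpoly (meval c) F)) ->
  is_morphism rho.
Proof.
move=> FG nz hrho; exists (local_iso_family FG nz) => p.
have [[] _ /choice[c pc]] := svalP p.
have [B rhoE BE] := hrho p c pc; exists B => // x v _ xv.
have fE l : ev iota (v 0) (tnth (birval B) l) =
    meval (v 0) (tnth (fiber F (sval p)) l).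
  rewrite BE !tnth_mktuple /ev mmap_map /meval mmap_map.
  apply: eq_mmap => // q /=; rewrite /meval rmorph_mmap /ev.
  by apply: eq_mmap => // i; rewrite /= -pc.
have -> : \row_l ev iota (v 0) (tnth (birval B) l) =
    eval_tuple (fiber F (sval p)) v by apply/rowP => l; rewrite !mxE fE.
case: FG => [[d hF] _ _ _ _ _] [l nl] /=.
apply: (hcoords_act (fiber_homog (sval p) hF) xv); apply/eval_tuple_eq0.
by exists l; rewrite -fE.
Qed.

End Family.

(** * Polynomial representatives of birational maps *)

Section Represents.
Variables (k : fieldType) (n : nat).
Implicit Types (f g : bir k n) (F G : ptuple k n).

Lemma represents_ex f : exists F G, represents f F /\ hinverse F G.
Proof.
have [_ [G FG]] := birrepP (repr f).
by exists (repr f), G; split=> //; exists (repr f); rewrite ?reprK.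
Qed.

Lemma represents_mk F : is_birational F -> exists f, represents f F.
Proof. by move=> h; exists (\pi_(bir k n) (mkbir h)), (mkbir h). Qed.

Lemma represents_hmap f F : represents f F -> is_hmap F.
Proof. by case=> B _ <-; case: (birrepP B). Qed.

Lemma represents_eq f g F G : represents f F -> represents g G ->
  f = g <-> hsim F G.
Proof. by case=> B -> <- [C -> <-]; rewrite birP. Qed.

Lemma represents_mul f g F G : represents f F -> represents g G ->
  represents (f * g)%g (compose F G).
Proof.
case=> B -> <- [C -> <-]; exists (comp_rep B C) => //.
exact: bir_mulE.
Qed.

Lemma represents_one : represents 1%g (hid k n).
Proof. by exists (mkbir (@bir_hid k n)). Qed.

Lemma represents_inv f F G : represents f F -> hinverse F G ->
  represents (f^-1)%g G.
Proof.
case=> B fE BE FG; rewrite -BE in FG.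
have [g rg] := represents_mk (hinverse_bir FG).
have rf : represents f B by exists B.
suff -> : (f^-1)%g = g by [].
apply: (mulgI f); rewrite mulgV.
apply/(represents_eq represents_one (represents_mul rf rg)).
by case: FG => _ [_ /hsim_sym].
Qed.

Lemma local_iso_hinverse F G a b : local_iso F G a b -> a != 0 -> b != 0 ->
  is_hmap F /\ hinverse F G.
Proof.
have half F' G' a' b' : local_iso F' G' a' b' -> a' != 0 -> b' != 0 ->
    is_hmap F' /\
    (exists i, tnth (compose G' F') i != 0) /\ hsim (compose G' F') (hid k n).
  case=> [hF [e hG] GF _ bF bG] nza nzb; split; last split.
  - by split=> //; exists ord0; apply: base_neq0 bF nza.
  - exists ord0; apply: (base_neq0 (base_comp hG bG bF)).
    by rewrite mulf_neq0 // expf_neq0.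
  - by move=> i j; rewrite !(tnth_mktuple (fun i => 'X_i)).
move=> FG nza nzb; have [hF iF] := half _ _ _ _ FG nza nzb.
have [hG iG] := half _ _ _ _ (local_iso_sym FG) nzb nza.
exact: (conj hF (And3 hG iG iF)).
Qed.

Definition fixes_base f : Prop := exists F G a b,
  [/\ local_iso F G a b, a != 0, b != 0 & represents f F].

End Represents.

(** * One-parameter families *)

Section OneParameter.
Variables (k : fieldType) (K : closedFieldType) (iota : {rmorphism k -> K}).
Variables (h : {poly k}).

(** The complement of the zeros of [h] in the affine line, as the plane curve
    [y * h(t) = 1]. *)
Definition open_line_eqn : {mpoly k[2]} :=
  'X_1 * (map_poly (@mpolyC 2 k) h).['X_0] - 1.

Notation D := (affine_variety iota [:: open_line_eqn]).

Definition line_pt (t : k) (i : 'I_2) : k := if i == 0 then t else h.[t]^-1.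

Lemma open_lineP (z : D) :
  coordA z 1 * (map_poly iota h).[coordA z 0] = 1.
Proof.
have : ev iota (coordA z) open_line_eqn = 0.
  by have /= /andP[/eqP] := svalP z.
move/eqP; rewrite rmorphB rmorphM rmorph1 /= evX -horner_map /= evX.
rewrite -map_poly_comp subr_eq0 => /eqP <-; congr (_ * _.[_]).
by apply: eq_map_poly => c; rewrite /= /ev mmapC.
Qed.

Lemma line_pt_proof t : h.[t] != 0 ->
  all (fun P => ev iota [ffun i => iota (line_pt t i)] P == 0)
    [:: open_line_eqn].
Proof.
move=> ht; rewrite /= andbT rmorphB rmorphM rmorph1 /= evX -horner_map /= evX.
rewrite -map_poly_comp !ffunE.
rewrite (eq_map_poly (g := iota)) => [|c]; last by rewrite /= /ev mmapC.
by rewrite horner_map -rmorphM /line_pt /= mulVf // rmorph1 subrr.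
Qed.

Definition line_point t (ht : h.[t] != 0) : D :=
  exist (fun z : {ffun 'I_2 -> K} => all (fun P => ev iota z P == 0) _)
    _ (line_pt_proof ht).

Lemma ev_line_point t (ht : h.[t] != 0) p :
  ev iota (coordA (line_point ht)) p = iota (meval (line_pt t) p).
Proof.
rewrite /meval rmorph_mmap; apply: eq_mmap => // i.
by rewrite /coordA /= ffunE.
Qed.

Lemma clear_denominators (P : {mpoly k[2]}) :
  exists q : {poly k}, exists N, forall t, h.[t] != 0 ->
    q.[t] = h.[t] ^+ N * meval (line_pt t) P.
Proof.
pose q := \sum_(u <- msupp P) P@_u *: ('X^(u 0%R) * h ^+ (msize P - u 1%R)).
exists q, (msize P) => t ht; rewrite mevalE mulr_sumr horner_sum.
rewrite big_seq [RHS]big_seq; apply: eq_bigr => u uP.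
rewrite hornerZ hornerM hornerXn horner_exp !big_ord_recl big_ord0 mulr1.
rewrite [RHS]mulrCA; congr (_ * _); rewrite [RHS]mulrCA; congr (_ * _).
have le : (u 1%R <= msize P)%N.
  rewrite ltnW // (leq_ltn_trans _ (msize_mdeg_lt uP)) //.
  by rewrite mdegE (bigD1 (1 : 'I_2)) //= leq_addr.
have -> : lift ord0 ord0 = 1 :> 'I_2 by apply: val_inj.
rewrite /line_pt /= -{2}(subnK le) exprD -mulrA exprVn mulfV ?mulr1 //.
exact: expf_neq0.
Qed.

Variable n : nat.
Implicit Types (chi : k -> bir k n).

(** The ring of the parameter curve is represented by polynomials in the two
    variables [t] and [1 / h t], which are not reduced modulo its equation: the
    identities in [local_iso] hold before reduction. *)
Definition pointed_family chi : Prop :=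
  exists (F G : n.+1.-tuple {mpoly {mpoly k[2]}[n.+1]}) (a b : {mpoly k[2]}),
    [/\ local_iso F G a b, a != 0, b != 0,
        forall z : D, ev iota (coordA z) a != 0 /\ ev iota (coordA z) b != 0 &
        forall t, h.[t] != 0 ->
          represents (chi t) (map_tuple_mpoly (meval (line_pt t)) F)].

Lemma pointed_family_mul chi1 chi2 :
  pointed_family chi1 -> pointed_family chi2 ->
  pointed_family (fun t => chi1 t * chi2 t)%g.
Proof.
move=> [F1 [G1 [a1 [b1 [i1 na1 nb1 nz1 r1]]]]].
move=> [F2 [G2 [a2 [b2 [i2 na2 nb2 nz2 r2]]]]].
have [d [e i12]] := comp_local_iso i1 i2 nb1 na2.
exists (compose F1 F2), (compose G2 G1), (a2 ^+ d * a1), (b1 ^+ e * b2).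
split=> //; try by rewrite mulf_neq0 ?expf_neq0.
  move=> z; have [[x1 y1] [x2 y2]] := (nz1 z, nz2 z).
  by rewrite !rmorphM !rmorphXn !mulf_neq0 ?expf_neq0.
move=> t ht; rewrite map_compose.
exact: represents_mul (r1 t ht) (r2 t ht).
Qed.

Lemma pointed_family_inv chi :
  pointed_family chi -> pointed_family (fun t => (chi t)^-1)%g.
Proof.
move=> [F [G [a [b [i1 na nb nz r]]]]].
exists G, F, b, a; split; [exact: local_iso_sym | by [] | by [] | | ].
  by move=> z; have [] := nz z.
move=> t ht; have [] := nz (line_point ht).
rewrite !ev_line_point !fmorph_eq0 => nat nbt.
apply: (represents_inv (r t ht)).
by have [] := local_iso_hinverse (map_local_iso (meval (line_pt t)) i1) nat nbt.
Qed.

Lemma pointed_family_const f : fixes_base f -> pointed_family (fun=> f).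
Proof.
move=> [F [G [a [b [i1 na nb r]]]]].
exists (map_tuple_mpoly (@mpolyC 2 k) F), (map_tuple_mpoly (@mpolyC 2 k) G).
have evC (z : D) c : ev iota (coordA z) c%:MP = iota c by rewrite /ev mmapC.
exists a%:MP, b%:MP; split.
- exact: map_local_iso.
- by rewrite mpolyC_eq0.
- by rewrite mpolyC_eq0.
- by move=> z; rewrite !evC !fmorph_eq0.
move=> t ht; suff -> : map_tuple_mpoly (meval (line_pt t))
    (map_tuple_mpoly (@mpolyC 2 k) F) = F by [].
apply: eq_from_tnth => i; rewrite !tnth_mktuple.
by apply/mpolyP => u; rewrite !mcoeff_map_mpoly /= mevalC.
Qed.

(** On the open line, a closed condition is a set of polynomials in [t] and
    [1 / h t]; after multiplication by powers of [h t] they become polynomials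
    in [t], which vanish as soon as they do on a dense set of parameters. *)
Lemma closed_pointed_family (N : set (bir k n)) chi (S : k -> Prop) :
  zariski_closed iota N -> pointed_family chi ->
  (forall q : {poly k}, (forall t, S t -> q.[t] = 0) -> q = 0) ->
  (forall t, S t -> h.[t] != 0 -> N (chi t)) ->
  forall t, h.[t] != 0 -> N (chi t).
Proof.
move=> cN [F [G [a [b [i1 na nb nz r]]]]] dS NS t ht.
have kp (p : kpoints D) : exists c : 'I_2 -> k,
    forall l, coordA (sval p) l = iota (c l).
  by have [[] _ /choice[c pc]] := svalP p; exists c.
have kpE (p : kpoints D) c : (forall l, coordA (sval p) l = iota (c l)) ->
    h.[c 0] != 0 /\ c =1 line_pt (c 0).
  move=> pc; have := open_lineP (sval p).
  rewrite !pc horner_map -rmorphM -(rmorph1 iota) => /fmorph_inj e.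
  have hc : h.[c 0] != 0.
    by apply: contraNneq (oner_neq0 k) => h0; rewrite -e h0 mulr0.
  split=> // i; rewrite /line_pt; case: eqP => [->//|].
  move=> i0; have -> : i = 1.
    by case: i i0 => -[|[|//]] lt i0; [case: i0|]; apply: val_inj.
  by rewrite -[RHS]mul1r -e mulfK.
pose rho p := chi (projT1 (cid (kp p)) 0).
have rhoE p c : (forall l, coordA (sval p) l = iota (c l)) -> rho p = chi (c 0).
  move=> pc; congr chi; apply: (fmorph_inj iota); rewrite -pc.
  by case: cid => c' /= ->.
have mrho : is_morphism rho.
  apply: (local_iso_morphism i1 nz) => p c pc.
  have [hc cE] := kpE p c pc; rewrite (rhoE p c pc).
  suff -> : map_tuple_mpoly (meval c) F =
    map_tuple_mpoly (meval (line_pt (c 0))) F by apply: r.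
  apply: eq_from_tnth => i; rewrite !tnth_mktuple.
  apply/mpolyP => u; rewrite !mcoeff_map_mpoly /=; exact: meval_eq.
have [E EP] := cN D rho mrho tt.
have pt_kp s (hs : h.[s] != 0) : is_kpoint (line_point hs).
  by exists tt => // l; exists (line_pt s l); rewrite /= ffunE.
have NE s (hs : h.[s] != 0) :
    N (chi s) <-> forall P, E P -> meval (line_pt s) P = 0.
  have := EP (exist _ _ (pt_kp s hs)) I; rewrite /preimage /=.
  rewrite (rhoE _ (line_pt s)) => [->|l]; last by rewrite /coordA /= ffunE.
  split=> H P /H; have /= evE := ev_line_point hs P; rewrite /coordA /= in evE.
    by rewrite evE => /eqP; rewrite fmorph_eq0 => /eqP.
  by rewrite evE => ->; rewrite rmorph0.
apply/NE => // P PE; have [q [M qE]] := clear_denominators P.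
have qh0 : q * h = 0.
  apply: dS => s Ss; rewrite hornerM; have [->|hs] := eqVneq h.[s] 0.
    by rewrite mulr0.
  by rewrite qE // ((NE s hs).1 (NS s Ss hs)) // mulr0 mul0r.
have : h.[t] ^+ M * meval (line_pt t) P * h.[t] = 0.
  by rewrite -qE // -hornerM qh0 horner0.
by move/eqP; rewrite !mulf_eq0 expf_eq0 (negPf ht) andbF orbF => /eqP.
Qed.

End OneParameter.

(** * Linear maps *)

Section Linear.
Variables (k : fieldType) (n : nat).
Implicit Types (A B : 'M[k]_n.+1) (F G : ptuple k n).

Definition lin_form (r : 'rV[k]_n.+1) : {mpoly k[n.+1]} :=
  \sum_j r 0 j *: 'X_j.

Definition lin_tuple A : ptuple k n := [tuple lin_form (row i A) | i < n.+1].

Lemma lin_form_homog r : lin_form r \is 1.-homog.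
Proof.
apply: rpred_sum => j _; apply: rpredZ.
by rewrite dhomogX; apply/eqP; apply: mdeg1.
Qed.

Lemma mcoeff_lin_form r j : (lin_form r)@_(U_(j)) = r 0 j.
Proof.
rewrite raddf_sum /= (bigD1 j) //= mcoeffZ mcoeffXU eqxx mulr1 big1 ?addr0 //.
by move=> i ij; rewrite mcoeffZ mcoeffXU (negPf ij) mulr0.
Qed.

Lemma lin_form_eq0 r : lin_form r = 0 -> r = 0.
Proof.
by move=> e; apply/rowP => j; rewrite -mcoeff_lin_form e mcoeff0 mxE.
Qed.

Lemma lin_form_comp r F : lin_form r \mPo F = \sum_j r 0 j *: tnth F j.
Proof.
rewrite raddf_sum; apply: eq_bigr => j _ /=.
by rewrite comp_mpolyZ comp_mpolyXU -tnth_nth.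
Qed.

Lemma lin_form_sum (r : 'rV[k]_n.+1) A :
  \sum_j r 0 j *: lin_form (row j A) = lin_form (r *m A).
Proof.
rewrite /lin_form; under eq_bigr do rewrite scaler_sumr.
rewrite exchange_big /=; apply: eq_bigr => l _.
rewrite mxE scaler_suml; apply: eq_bigr => j _.
by rewrite scalerA mxE.
Qed.

Lemma compose_lin A B :
  compose (lin_tuple A) (lin_tuple B) = lin_tuple (A *m B).
Proof.
apply: eq_from_tnth => i; rewrite composeE !tnth_mktuple lin_form_comp.
rewrite row_mul -lin_form_sum; apply: eq_bigr => j _.
by rewrite tnth_mktuple.
Qed.

Lemma lin_tuple1 : lin_tuple 1%:M = hid k n.
Proof.
apply: eq_from_tnth => i; rewrite !tnth_mktuple /lin_form (bigD1 i) //=.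
rewrite !mxE eqxx scale1r big1 ?addr0 // => j ji.
by rewrite !mxE eq_sym (negPf ji) scale0r.
Qed.

Lemma eval_lin A v : eval_tuple (lin_tuple A) v = v *m A^T.
Proof.
apply/rowP => i; rewrite !mxE tnth_mktuple raddf_sum /=; apply: eq_bigr => j _.
by rewrite mevalZ mevalXU !mxE mulrC.
Qed.

Lemma lin_nonzero A : A \in unitmx -> exists i, tnth (lin_tuple A) i != 0.
Proof.
move=> uA; exists ord0; rewrite tnth_mktuple; apply/eqP => /lin_form_eq0 e.
have : row ord0 A *m invmx A = 0 by rewrite e mul0mx.
rewrite -row_mul mulmxV // => /rowP/(_ ord0); rewrite !mxE eqxx.
by move/eqP; rewrite oner_eq0.
Qed.

Lemma lin_birational A : A \in unitmx -> is_birational (lin_tuple A).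
Proof.
have hA B : B \in unitmx -> is_hmap (lin_tuple B).
  move=> uB; split; first exact: lin_nonzero.
  by exists 1%N => i; rewrite tnth_mktuple lin_form_homog.
move=> uA; split; first exact: hA.
have e1 : hcomp (lin_tuple A) (lin_tuple (invmx A)) = hid k n.
  by rewrite -lin_tuple1 -(mulmxV uA); apply: compose_lin.
have e2 : hcomp (lin_tuple (invmx A)) (lin_tuple A) = hid k n.
  by rewrite -lin_tuple1 -(mulVmx uA); apply: compose_lin.
exists (lin_tuple (invmx A)); split; first by apply: hA; rewrite unitmx_inv.
  by rewrite e1; split; [exact: nz_hid | exact: hsim_refl].
by rewrite e2; split; [exact: nz_hid | exact: hsim_refl].
Qed.

(** Singular matrices are sent to the identity. *)
Definition lin A : bir k n :=
  if pselect (is_birational (lin_tuple A)) is left h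
  then \pi_(bir k n) (mkbir h) else 1%g.

Lemma represents_lin A : A \in unitmx -> represents (lin A) (lin_tuple A).
Proof.
move=> /lin_birational b; rewrite /lin; case: pselect => // h.
by exists (mkbir h).
Qed.

Lemma linM A B : A \in unitmx -> B \in unitmx ->
  lin (A *m B) = (lin A * lin B)%g.
Proof.
move=> uA uB; have uAB : A *m B \in unitmx by rewrite unitmx_mul uA.
apply/(represents_eq (represents_lin uAB)
  (represents_mul (represents_lin uA) (represents_lin uB))).
by rewrite compose_lin; apply: hsim_refl.
Qed.

Lemma lin_scale c A : c != 0 -> A \in unitmx -> lin (c *: A) = lin A.
Proof.
move=> nz uA; have ucA : c *: A \in unitmx by rewrite unitmxZ ?unitfE.
apply/(represents_eq (represents_lin ucA) (represents_lin uA)).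
have cE i : tnth (lin_tuple (c *: A)) i = c *: tnth (lin_tuple A) i.
  rewrite !tnth_mktuple /lin_form scaler_sumr; apply: eq_bigr => j _.
  by rewrite !mxE scalerA.
by move=> i j; rewrite !cE -!scalerAl mulrC.
Qed.

Lemma lin1 : lin 1%:M = 1%g.
Proof.
apply/(represents_eq (represents_lin (unitmx1 _ _)) (represents_one _ _)).
by rewrite lin_tuple1; apply: hsim_refl.
Qed.

Lemma linV A : A \in unitmx -> lin (invmx A) = (lin A)^-1%g.
Proof.
move=> uA; apply: (mulgI (lin A)).
by rewrite -linM ?unitmx_inv // mulmxV // lin1 mulgV.
Qed.

(** A linear relation between the components of [F] pulls back under the inverse
    [G] to a linear relation between the variables. *)
Lemma hinverse_lin_indep F G (r : 'rV[k]_n.+1) : hinverse F G ->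
  \sum_i r 0 i *: tnth F i = 0 -> r = 0.
Proof.
move=> [_ [[l nl] FG] _] e; apply: lin_form_eq0; apply: (mulfI nl).
rewrite mulr0 /lin_form mulr_sumr.
transitivity (((\sum_i r 0 i *: tnth F i) \mPo G) * 'X_l); last first.
  by rewrite e comp_mpoly0 mul0r.
rewrite raddf_sum mulr_suml; apply: eq_bigr => j _ /=.
rewrite comp_mpolyZ -scalerAr -scalerAl; congr (_ *: _).
by have := FG j l; rewrite !tnth_mktuple => ->.
Qed.

End Linear.

(** * Contracting a birational map towards a fixed point *)

Lemma meval_base (R : comNzRingType) n d (p : {mpoly R[n.+1]}) :
  p \is d.-homog -> meval (@basept n R) p = p@_(U_(ord0) *+ d)%MM.
Proof.
move=> /dhomogP hp; rewrite mevalE.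
have e (u : 'X_{1..n.+1}) :
    \prod_i basept R i ^+ u i = (u == (U_(ord0) *+ u ord0)%MM)%:R :> R.
  case: eqP => [->|ne].
    rewrite big1 // => i _; rewrite /basept mulmnE mnm1E eq_sym.
    by case: eqP => [_|_]; rewrite ?expr1n ?mul0n ?expr0.
  have [i /andP[i0 ui]] : exists i, (i != ord0) && (u i != 0%N).
    apply: contra_notP ne => h; apply/mnmP => i; rewrite mulmnE mnm1E.
    case: (eqVneq i ord0) => [->|i0]; first by rewrite mul1n.
    rewrite mul0n; apply: contra_notP h => /eqP ui.
    by exists i; rewrite i0 ui.
  by rewrite (bigD1 i) //= /basept (negPf i0) expr0n (negPf ui) mul0r.
pose v : 'X_{1..n.+1} := (U_(ord0) *+ d)%MM.
rewrite -/v; have [vp|vp] := boolP (v \in msupp p); last first.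
  rewrite (memN_msupp_eq0 vp) big_seq big1 // => u up; rewrite e.
  have du : mdeg u = d := hp u up.
  case: eqP => [ue|_]; last by rewrite mulr0.
  case/negP: vp; have -> : v = u; last by [].
  by rewrite ue /v -du ue !mdegMn mdeg1 !mul1n mulmnE mnm1E eqxx mul1n.
rewrite (bigD1_seq v) //= e big_seq_cond big1 ?addr0.
  by rewrite {1}/v {1}/v mulmnE mnm1E eqxx mul1n eqxx mulr1.
move=> u /andP[up uv]; rewrite e; have du : mdeg u = d := hp u up.
case: eqP => [ue|_]; last by rewrite mulr0.
case/eqP: uv; rewrite ue /v -du ue !mdegMn mdeg1 !mul1n.
by rewrite mulmnE mnm1E eqxx mul1n.
Qed.

Section Contract.
Variables (k : fieldType) (n : nat).
Implicit Types (F G : ptuple k n).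

(** The conjugate of [F], of degree [d], by the homothety of ratio [t]: its
    components are [F_0(x_0, t x')] and [F_i(x_0, t x') / t] for [i > 0].  The
    division is possible because [F_i] has no term in [x_0 ^ d] when [F] fixes
    the base point; the subtraction is truncated only for that term. *)
Definition contract (R : comNzRingType) (io : k -> R) (t : R) d F :
    n.+1.-tuple {mpoly R[n.+1]} :=
  [tuple \sum_(u <- msupp (tnth F i))
      (io (tnth F i)@_u * t ^+ (d - u ord0 - (i != ord0))) *: 'X_[u]
    | i < n.+1].

Definition homothety (R : comNzRingType) (t : R) :
    n.+1.-tuple {mpoly R[n.+1]} :=
  [tuple t ^+ (i != ord0) *: 'X_i | i < n.+1].

Lemma mcoeff_contract (R : comNzRingType) (io : {rmorphism k -> R}) t d F i v :
  (tnth (contract io t d F) i)@_v =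
  io (tnth F i)@_v * t ^+ (d - v ord0 - (i != ord0)).
Proof.
rewrite tnth_mktuple raddf_sum /=.
have [vF|vF] := boolP (v \in msupp (tnth F i)).
  rewrite (bigD1_seq v) //= mcoeffZ mcoeffX eqxx mulr1 big1 ?addr0 // => u uv.
  by rewrite mcoeffZ mcoeffX (negPf uv) mulr0.
rewrite (memN_msupp_eq0 vF) rmorph0 mul0r big_seq big1 // => u uF.
rewrite mcoeffZ mcoeffX; case: (u =P v) => [uv|_]; last by rewrite mulr0.
by rewrite -uv uF in vF.
Qed.

Lemma map_contract (R S : comNzRingType) (io : {rmorphism k -> R})
    (jo : {rmorphism k -> S}) (phi : {rmorphism R -> S}) t d F :
  (forall c, phi (io c) = jo c) ->
  map_tuple_mpoly phi (contract io t d F) = contract jo (phi t) d F.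
Proof.
move=> pij; apply: eq_from_tnth => i; apply/mpolyP => v.
rewrite mcoeff_contract (tnth_mktuple (fun i => map_mpoly phi _)).
rewrite mcoeff_map_mpoly mcoeff_contract -pij -rmorphXn; exact: rmorphM.
Qed.

Section Domain.
Variables (R : idomainType) (io : {rmorphism k -> R}) (t : R).
Hypothesis nzt : t != 0.

Lemma compose_homothety (C : n.+1.-tuple {mpoly R[n.+1]}) i :
  tnth (compose (homothety t) C) i = t ^+ (i != ord0) *: tnth C i.
Proof.
by rewrite composeE tnth_mktuple comp_mpolyZ comp_mpolyXU -tnth_nth.
Qed.

Lemma contract_homothety d F a :
  (forall i, tnth F i \is d.-homog) ->
  (forall i, meval (@basept n k) (tnth F i) = a * basept k i) ->
  compose (homothety t) (contract io t d F) =
  compose (map_tuple_mpoly io F) (homothety t).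
Proof.
move=> hF bF; apply: eq_from_tnth => i.
rewrite compose_homothety composeE !tnth_mktuple scaler_sumr.
rewrite /comp_mpoly mmap_map /mmap big_seq [RHS]big_seq.
apply: eq_bigr => u uF; have /dhomogP/(_ u uF) du := hF i.
have {}du : mdeg u = d := du.
(* The homothety multiplies the monomial [u] by [t] to its degree in the
   variables other than [x_0]. *)
have -> : mmap1 (tnth (homothety t)) u = t ^+ (d - u ord0) *: 'X_[u].
  rewrite /mmap1 mpolyXE_id.
  under eq_bigr do rewrite tnth_mktuple exprZn.
  rewrite scaler_prod; congr (_ *: _).
  under eq_bigr do rewrite -exprM.
  rewrite prodrXr; congr (_ ^+ _).
  rewrite -du mdegE (bigD1 ord0) //= mul0n add0n [in RHS](bigD1 ord0) //=.
  by rewrite addKn; apply: eq_bigr => j ->; rewrite mul1n.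
rewrite /= mul_mpolyC !scalerA mulrCA -exprD subnKC //.
(* For [i > 0] the exponent of [t] is positive: the monomial [x_0 ^ d] does not
   occur in [F_i]. *)
case: eqP => //= i0; rewrite subn_gt0 ltn_neqAle -{2}du mdegE.
rewrite (bigD1 ord0) //= leq_addr andbT; apply: contraTneq uF => u0.
have -> : u = (U_(ord0) *+ d)%MM.
  apply/mnmP => j; rewrite mulmnE mnm1E; case: (eqVneq j ord0) => [->|j0].
    by rewrite mul1n.
  rewrite mul0n; apply/eqP; move: (du); rewrite mdegE (bigD1 ord0) //= u0.
  move/eqP; rewrite -{2}[d]addn0 eqn_add2l sum_nat_eq0 => /forallP/(_ j).
  by rewrite j0.
rewrite mcoeff_msupp negbK -(meval_base (hF i)) bF /basept.
by rewrite (introF eqP i0) mulr0.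
Qed.

(** The homothety is injective on tuples, [t] being regular, so the relation
    between [F] and [G] transfers through [contract_homothety]. *)
Lemma contract_inv d e F G a b :
  (forall i, tnth F i \is d.-homog) -> (forall i, tnth G i \is e.-homog) ->
  (forall i, meval (@basept n k) (tnth F i) = a * basept k i) ->
  (forall i, meval (@basept n k) (tnth G i) = b * basept k i) ->
  collinear (tnth (compose G F)) (fun i => 'X_i) ->
  collinear (tnth (compose (contract io t e G) (contract io t d F)))
    (fun i => 'X_i).
Proof.
move=> hF hG bF bG inv.
pose P := compose (contract io t e G) (contract io t d F).
have PE : compose (homothety t) P =
    compose (map_tuple_mpoly io (compose G F)) (homothety t).
  rewrite /P composeA (contract_homothety hG bG) -composeA.
  by rewrite (contract_homothety hF bF) composeA map_compose.
have eqi i : (t ^+ (i != ord0))%:MP * tnth P i =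
    map_mpoly io (tnth (compose G F) i) \mPo homothety t.
  rewrite mul_mpolyC -compose_homothety PE composeE.
  by rewrite (tnth_mktuple (fun i => map_mpoly io _)).
have eqX i :
    (t ^+ (i != ord0))%:MP * 'X_i = map_mpoly io 'X_i \mPo homothety t.
  by rewrite map_mpolyXU comp_mpolyXU mul_mpolyC -tnth_nth tnth_mktuple.
move=> i j; pose c l : {mpoly R[n.+1]} := (t ^+ (l != ord0 :> 'I_n.+1))%:MP.
have nzc : c i * c j != 0.
  by rewrite -mpolyCM mpolyC_eq0 mulf_neq0 ?expf_neq0.
apply: (mulfI nzc); rewrite [LHS]mulrACA [c i * c j]mulrC [RHS]mulrACA.
rewrite /c !eqi !eqX -[LHS]rmorphM -[RHS]rmorphM; congr comp_mpoly.
by rewrite -[LHS]rmorphM -[RHS]rmorphM inv.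
Qed.

Lemma contract_base d F a :
  (forall i, tnth F i \is d.-homog) ->
  (forall i, meval (@basept n k) (tnth F i) = a * basept k i) ->
  forall i, meval (@basept n R) (tnth (contract io t d F) i) =
    io a * basept R i.
Proof.
move=> hF bF i; have nzc : t ^+ (i != ord0) != 0 by exact: expf_neq0.
apply: (mulfI nzc); rewrite -mevalZ -compose_homothety.
rewrite (contract_homothety hF bF) composeE comp_mpoly_meval tnth_mktuple.
rewrite (meval_eq (v2 := @basept n R)) => [|j].
  rewrite meval_map_base bF map_base /basept.
  by case: eqP; rewrite ?mul1r ?mulr0.
rewrite tnth_mktuple mevalZ mevalXU /basept.
by case: eqP; rewrite ?mul1r ?mulr0.
Qed.

Lemma contract_homog d F : (forall i, tnth F i \is d.-homog) ->
  forall i, tnth (contract io t d F) i \is d.-homog.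
Proof.
move=> hF i; rewrite tnth_mktuple big_seq; apply: rpred_sum => u uF.
by apply: rpredZ; rewrite dhomogX; have /dhomogP/(_ u uF)-> := hF i.
Qed.

Lemma contract_local_iso F G a b : local_iso F G a b ->
  exists d e,
    [/\ forall i, tnth F i \is d.-homog,
        forall i, meval (@basept n k) (tnth F i) = a * basept k i &
        local_iso (contract io t d F) (contract io t e G) (io a) (io b)].
Proof.
case=> [[d hF] [e hG] GF FG bF bG]; exists d, e; split=> //; split.
- by exists d; apply: contract_homog.
- by exists e; apply: contract_homog.
- exact: contract_inv hF hG bF bG GF.
- exact: contract_inv hG hF bG bF FG.
- exact: contract_base hF bF.
- exact: contract_base hG bG.
Qed.

End Domain.
End Contract.

Section Limit.
Variables (k : fieldType) (n : nat).
Implicit Types (F G : ptuple k n) (L : 'M[k]_n.+1).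

(** Block diagonal for the splitting of the coordinates into [x_0] and the
    others. *)
Definition block_diag L : Prop :=
  forall j : 'I_n.+1, j != ord0 -> L ord0 j = 0 /\ L j ord0 = 0.

(** Only the terms of lowest order of [F] at the fixed point survive when
    [t = 0]: the matrix [L] is the differential of [F] there. *)
Lemma contract0 d F a :
  (forall i, tnth F i \is d.+1.-homog) ->
  (forall i, meval (@basept n k) (tnth F i) = a * basept k i) ->
  exists2 L, block_diag L & forall i,
    tnth (contract idfun 0 d.+1 F) i = 'X_ord0 ^+ d * lin_form (row i L).
Proof.
move=> hF bF.
(* The surviving monomials are [u j], that is [x_0 ^ d * x_j]. *)
pose u (j : 'I_n.+1) := (U_(ord0) *+ d + U_(j))%MM.
have u0 j : u j ord0 = (d + (j == ord0))%N.
  by rewrite /u mnmDE mulmnE !mnm1E eqxx mul1n.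
pose L : 'M[k]_n.+1 :=
  \matrix_(i, j) ((tnth F i)@_(u j) * 0 ^+ ((j != ord0) - (i != ord0))).
exists L => [j j0|i].
  rewrite !mxE eqxx j0 expr1 mulr0; split=> //.
  have -> : u ord0 = (U_(ord0) *+ d.+1)%MM by rewrite /u mulmSr.
  by rewrite -(meval_base (hF j)) bF /basept (negPf j0) mulr0 mul0r.
apply/mpolyP => v; rewrite (mcoeff_contract (idfun : {rmorphism k -> k})) /=.
have uX j : 'X_ord0 ^+ d * 'X_j = 'X_[k, u j] by rewrite mpolyXn -mpolyXD.
rewrite /lin_form mulr_sumr raddf_sum /=.
have uI j l : (u j == u l) = (j == l).
  by rewrite /u eqm_add2l eq_mnm1.
under eq_bigr do rewrite -scalerAr uX mcoeffZ mcoeffX.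
have [/existsP[j /eqP <-]|nv] := boolP [exists j, u j == v].
  rewrite (bigD1 j) //= eqxx mulr1 big1 => [|l lj]; last first.
    by rewrite uI (negPf lj) mulr0.
  rewrite addr0 !mxE u0; congr (_ * _ ^+ (_ - _)).
  by case: (j == ord0); rewrite ?addn1 ?subnn // addn0 subSnn.
rewrite big1 => [|j _]; last first.
  case: eqP => [e|]; last by rewrite mulr0.
  by case/negP: nv; apply/existsP; exists j; rewrite e.
have [Fv|Fv] := eqVneq (tnth F i)@_v 0; first by rewrite Fv mul0r.
have dv : mdeg v = d.+1.
  by have /dhomogP/(_ v) := hF i; apply; rewrite mcoeff_msupp.
rewrite expr0n; case: (_ =P 0%N) => [/eqP|_]; last by rewrite mulr0.
rewrite subn_eq0 => le.
have le' : (d <= v ord0)%N.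
  rewrite leq_subLR in le.
  by rewrite -ltnS (leq_trans le) // -[X in (_ <= X)%N]addn1 leq_add2l leq_b1.
case/negP: nv; apply/existsP.
have : mdeg (v - U_(ord0) *+ d)%MM == 1%N.
  have vE : (v - U_(ord0) *+ d + U_(ord0) *+ d = v)%MM.
    apply: submK; apply/mnm_lepP => j; rewrite mulmnE mnm1E.
    by case: (eqVneq ord0 j) => [<-|]; rewrite ?mul1n ?mul0n.
  have := dv; rewrite -{1}vE mdegD mdegMn mdeg1 mul1n => /eqP.
  by rewrite -[d.+1]add1n eqn_add2r.
case/mdeg1P => j /eqP e; exists j; rewrite /u -e addmC.
apply/eqP/submK/mnm_lepP => l; rewrite mulmnE mnm1E.
by case: (eqVneq ord0 l) => [<-|]; rewrite ?mul1n ?mul0n.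
Qed.

Lemma map_tuple_id F : map_tuple_mpoly idfun F = F.
Proof.
apply: eq_from_tnth => i; rewrite tnth_mktuple; apply/mpolyP => u.
by rewrite (mcoeff_map_mpoly (idfun : {rmorphism k -> k})).
Qed.

Definition homothety_mx (t : k) : 'M[k]_n.+1 :=
  diag_mx (\row_i t ^+ (i != ord0)).

Lemma lin_homothety t : lin_tuple (homothety_mx t) = homothety n t.
Proof.
apply: eq_from_tnth => i; rewrite !tnth_mktuple /lin_form (bigD1 i) //=.
rewrite !mxE eqxx mulr1n big1 ?addr0 // => j ji.
by rewrite !mxE (eq_sym i j) (negPf ji) mulr0n scale0r.
Qed.

Lemma diag_unitmx (r : 'rV[k]_n.+1) : (forall i, r 0 i != 0) ->
  diag_mx r \in unitmx.
Proof.
move=> nz; rewrite unitmxE det_diag unitfE.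
by apply/prodf_neq0 => i _; apply: nz.
Qed.

Lemma homothety_unit t : t != 0 -> homothety_mx t \in unitmx.
Proof. by move=> nz; apply: diag_unitmx => i; rewrite mxE expf_neq0. Qed.

End Limit.

Section ContractionFamily.
Variables (k : fieldType) (K : closedFieldType) (iota : {rmorphism k -> K}).
Variable n : nat.
Hypothesis n_gt0 : (0 < n)%N.

(** The conjugate of [f] by the homothety of ratio [t] has a representative that
    is polynomial in [t]; at [t = 0] this is [x_0 ^ (d - 1)] times a linear
    map, by [contract0]. *)
Lemma contraction_family (f : bir k n) : fixes_base f ->
  exists (L : 'M[k]_n.+1) (chi : k -> bir k n),
    [/\ L \in unitmx /\ block_diag L, pointed_family iota 1 chi, chi 0 = lin L &
        forall t, t != 0 -> chi t = (f ^ lin (homothety_mx n t))%g].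
Proof.
move=> [F [G [a [b [FG nza nzb rF]]]]].
pose C := @mpolyC 2 k : {rmorphism k -> {mpoly k[2]}}.
have nzX : ('X_(0 : 'I_2) : {mpoly k[2]}) != 0 by rewrite -msupp_eq0 msuppX.
have [d [e [hF bF iFG]]] := contract_local_iso C nzX FG.
(* [Ft] is the specialisation at [t] of the contraction over the polynomial
   ring, whose ratio is the coordinate [t] of the parameter line. *)
pose Ft t := contract idfun t d F.
have FtE t :
    map_tuple_mpoly (meval (line_pt 1 t)) (contract C 'X_(0 : 'I_2) d F) = Ft t.
  rewrite (@map_contract _ _ _ _ C idfun) => [|c]; last exact: mevalC.
  by rewrite /= mevalXU.
have iFt t : exists G', is_hmap (Ft t) /\ hinverse (Ft t) G'.
  have := map_local_iso (meval (line_pt 1 t)) iFG; rewrite FtE /= !mevalC => i.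
  by eexists; apply: (local_iso_hinverse i).
have rFt t : exists g : bir k n, represents g (Ft t).
  by apply: represents_mk; have [G' [h1 h2]] := iFt t; split=> //; exists G'.
have [chi rchi] := choice rFt.
have d_gt0 : (0 < d)%N.
  (* In degree 0 the component [F_1], which vanishes at the base point, would
     be zero. *)
  rewrite lt0n; apply/eqP => d0; have [_ FGi] := local_iso_hinverse FG nza nzb.
  pose i1 : 'I_n.+1 := Ordinal (n_gt0 : (1 < n.+1)%N).
  have F1 : tnth F i1 = 0.
    apply/mpolyP => u; rewrite mcoeff0; apply/eqP; rewrite mcoeff_eq0.
    apply/negP => uF; have /dhomogP/(_ u uF) := hF i1.
    rewrite d0 => /eqP; rewrite mdeg_eq0 => /eqP u0; move: uF.
    rewrite u0 mcoeff_msupp; have := meval_base (hF i1).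
    by rewrite bF /basept mulr0 d0 mulm0n => <-; rewrite eqxx.
  have := hinverse_lin_indep (r := delta_mx 0 i1) FGi.
  rewrite (bigD1 i1) //= F1 scaler0 add0r big1 => [|j ji]; last first.
    by rewrite mxE (negPf ji) andbF scale0r.
  move=> /(_ erefl)/rowP/(_ i1); rewrite !mxE !eqxx => /eqP.
  by rewrite oner_eq0.
case: d d_gt0 => // d _ in hF Ft FtE iFt rFt rchi iFG *.
have [L bL LE] := contract0 hF bF.
have uL : L \in unitmx.
  (* The kernel of [L] gives linear relations between the components of the
     birational map [Ft 0]. *)
  have [G' [_ iG']] := iFt 0; rewrite -row_free_unit -kermx_eq0.
  apply/eqP/row_matrixP => i; rewrite row0.
  apply: (hinverse_lin_indep iG').
  under eq_bigr do rewrite LE scalerAr.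
  rewrite -mulr_sumr lin_form_sum -row_mul mulmx_ker row0 /lin_form.
  rewrite big1 ?mulr0 //.
  by move=> j _; rewrite mxE scale0r.
exists L, chi; split=> //.
- exists (contract C 'X_(0 : 'I_2) d.+1 F), (contract C 'X_(0 : 'I_2) e G).
  exists a%:MP, b%:MP; split; rewrite ?mpolyC_eq0 //.
  + by move=> z; rewrite /ev !mmapC !fmorph_eq0.
  + by move=> t _; rewrite FtE.
- apply/(represents_eq (rchi 0) (represents_lin uL)) => i j.
  by rewrite !LE ![tnth (lin_tuple _) _]tnth_mktuple mulrAC.
move=> t nzt; apply: (mulgI (lin (homothety_mx n t))).
have uh := homothety_unit n nzt.
rewrite /conjg mulVKg.
apply/(represents_eq (represents_mul (represents_lin uh) (rchi t))
  (represents_mul rF (represents_lin uh))).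
rewrite lin_homothety.
have := contract_homothety (idfun : {rmorphism k -> k}) t hF bF.
rewrite map_tuple_id => ->; exact: hsim_refl.
Qed.

End ContractionFamily.

(** * Polynomials over an infinite field *)

Section Infinite.
Variable k : fieldType.
Hypothesis k_inf : infinite_set [set: k].

Lemma poly_nonroot (q : {poly k}) : q != 0 -> exists c, q.[c] != 0.
Proof.
move=> nz; apply: contrapT => h.
have [B _ leB] := infinite_set_fset (size q) k_inf.
have := max_poly_roots nz (rs := B) _ (fset_uniq B).
rewrite ltnNge leB => H; suff : false by []; apply: H.
by apply/allP => c _; apply/eqP/eqP; apply: contra_notT h => ?; exists c.
Qed.

(** Induction on the number of variables: as a polynomial in the last variable,
    [P] has a nonzero coefficient, which is nonzero at some point [v]; the
    polynomial in one variable obtained by specialising at [v] is then nonzero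
    and has a non-root. *)
Lemma mpoly_nonroot n (P : {mpoly k[n]}) : P != 0 ->
  exists v : 'I_n -> k, meval v P != 0.
Proof.
elim: n P => [|n IH] P nz.
  exists (fun=> 0); move: nz; rewrite [P]nvar0_mpolyC mevalC mpolyC_eq0 //.
have [u uP] : exists u, u \in msupp P.
  by exists (mlead P); apply: mlead_supp.
pose w := [multinom u (widen_ord (leqnSn n) i) | i < n].
have nzc : (muni P)`_(u ord_max) != 0.
  apply: contraTneq uP => c0; rewrite mcoeff_msupp negbK.
  have := congr1 (mcoeff w) c0; rewrite mcoeff0 muniE coef_sum raddf_sum /=.
  have [//|Pu] := eqVneq P@_u 0.
  have uP : u \in msupp P by rewrite mcoeff_msupp.
  rewrite (bigD1_seq u) //= coefZ coefXn eqxx mulr1 mcoeffZ mcoeffX eqxx.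
  rewrite mulr1 big1 ?addr0 => [P0|m mu]; first by rewrite P0 eqxx in Pu.
  rewrite coefZ coefXn; case: eqP => [e|_]; last by rewrite mulr0 mcoeff0.
  rewrite mulr1 mcoeffZ mcoeffX; case: eqP => [mw|_]; last by rewrite mulr0.
  case/eqP: mu; apply/mnmP => i.
  have [j ->|->] := unliftP ord_max i; last by rewrite e.
  have := congr1 (fun m : 'X_{1..n} => m j) mw; rewrite /w !mnmE.
  by congr (_ = _); congr (_ _); apply: val_inj;
    rewrite /= /bump leqNgt ltn_ord.
have [v nzv] := IH _ nzc.
have nzq : map_poly (meval v) (muni P) != 0.
  apply: contraNneq nzv => q0; have := coef_map (meval v) (muni P) (u ord_max).
  by rewrite q0 coef0 => <-.
have [c nzqc] := poly_nonroot nzq.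
have [X XE] : exists X, muni P = mmap (polyC \o @mpolyC n k) X P.
  by eexists; rewrite /muni.
exists (fun i => (map_poly (meval v) (X i)).[c]).
move: nzqc; rewrite XE.
have := rmorph_mmap (horner_eval c \o map_poly (meval v))
  (polyC \o @mpolyC n k) X P.
rewrite /= /horner_eval => ->; apply: contraNneq => <-; apply/eqP.
apply: eq_mmap => // a /=.
by rewrite /horner_eval /= map_polyC hornerC /= mevalC.
Qed.

End Infinite.

(** * Generators of the general linear group *)

Section Matrices.
Variable F : fieldType.

(** Completion of independent rows to a basis, read off the Gaussian elimination
    [A = L * (1 | 0) * U]. *)
Lemma row_free_complete m r (A : 'M[F]_(m, m + r)) : row_free A ->
  exists2 g, g \in unitmx & usubmx g = A.
Proof.
move=> /eqP rA; have := mulmx_ebase A; rewrite rA pid_mx_row => AE.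
pose g : 'M[F]_(m + r) := block_mx (col_ebase A) 0 0 1%:M *m row_ebase A.
exists g.
  rewrite unitmx_mul row_ebase_unit andbT unitmxE det_lblock det1 mulr1.
  by rewrite -unitmxE col_ebase_unit.
rewrite -mul_usub_mx.
by rewrite /block_mx col_mxKu -[RHS]AE mul_mx_row mulmx1 mulmx0.
Qed.

Variable n : nat.
Implicit Types (u x : 'cV[F]_n) (v y : 'rV[F]_n) (A M : 'M[F]_n).

(** A dilatation when [v u] is nonzero, a transvection or the identity when it
    vanishes. *)
Definition pseudorefl u v : 'M[F]_n := 1%:M + u *m v.

Lemma mulmx11 m l r (u : 'M[F]_(m, 1)) (c : 'M[F]_(1, l)) (d : 'M[F]_(l, 1))
    (v : 'M[F]_(1, r)) :
  u *m c *m (d *m v) = (c *m d) 0 0 *: (u *m v).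
Proof.
rewrite mulmxA -(mulmxA u) {1}[c *m d]mx11_scalar mul_mx_scalar.
by rewrite scalemxAl.
Qed.

Lemma pseudoreflM u v v' :
  pseudorefl u v *m pseudorefl u v' =
  pseudorefl u (v + v' + (v *m u) 0 0 *: v').
Proof.
rewrite /pseudorefl mulmxDl mul1mx mulmxDr mulmx1 mulmx11 !mulmxDr -scalemxAr.
by rewrite -!addrA; congr (_ + _); rewrite addrCA.
Qed.

Lemma pseudorefl0 u : pseudorefl u 0 = 1%:M.
Proof. by rewrite /pseudorefl mulmx0 addr0. Qed.

Lemma pseudorefl_inv u v : 1 + (v *m u) 0 0 != 0 ->
  pseudorefl u v *m pseudorefl u (- (1 + (v *m u) 0 0)^-1 *: v) = 1%:M.
Proof.
set c := (v *m u) 0 0 => nz.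
rewrite pseudoreflM -/c -(pseudorefl0 u); congr pseudorefl.
rewrite -addrA -{1}[X in X + c *: _]scale1r -scalerDl scalerA mulrN mulfV //.
by rewrite scaleN1r subrr.
Qed.

Lemma pseudorefl_unit u v : 1 + (v *m u) 0 0 != 0 -> pseudorefl u v \in unitmx.
Proof. by move/pseudorefl_inv/mulmx1_unit => []. Qed.

(** A vector space is not the union of two proper subspaces, here the left
    kernels of [M] and [M']. *)
Lemma two_mx_neq0 m p q (M : 'M[F]_(m, p)) (M' : 'M[F]_(m, q)) :
  M != 0 -> M' != 0 ->
  exists y : 'rV[F]_m, y *m M != 0 /\ y *m M' != 0.
Proof.
move=> /matrix0Pn[i [a Mia]] /matrix0Pn[j [b Mjb]].
have row0 r l (B : 'M[F]_(r, l)) c e : B c e != 0 -> row c B != 0.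
  by apply: contraNneq => /rowP/(_ e); rewrite !mxE => ->.
have [r1|r1] := eqVneq (row i M') 0; last first.
  by exists (delta_mx 0 i); rewrite -!rowE r1 (row0 _ _ _ _ _ Mia).
have [r2|r2] := eqVneq (row j M) 0; last first.
  by exists (delta_mx 0 j); rewrite -!rowE r2 (row0 _ _ _ _ _ Mjb).
exists (delta_mx 0 i + delta_mx 0 j); rewrite !mulmxDl -!rowE r1 r2 addr0 add0r.
by rewrite (row0 _ _ _ _ _ Mia) (row0 _ _ _ _ _ Mjb).
Qed.

(** Wedderburn's rank reduction: the rows of the difference are combinations of
    those of [M], and they all annihilate [x], which the rows of [M] do not. *)
Lemma wedderburn M x y : (y *m M *m x) 0 0 != 0 ->
  (\rank (M - ((y *m M *m x) 0 0)^-1 *: (M *m x *m (y *m M)))%R < \rank M)%N.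
Proof.
set c := (y *m M *m x) 0 0 => nzc; apply: rank_ltmx.
set M2 := M - _; have M2x : M2 *m x = 0.
  rewrite /M2 mulmxBl -scalemxAl -(mulmxA (M *m x)).
  rewrite [y *m M *m x]mx11_scalar mul_mx_scalar -/c.
  by rewrite scalerA mulVf // scale1r subrr.
rewrite ltmxE; apply/andP; split.
  apply/submxP; exists (1%:M - c^-1 *: (M *m x *m y)).
  by rewrite mulmxBl mul1mx -scalemxAl /M2 !mulmxA.
apply/negP => /submxP[B MB]; move/eqP: nzc; apply.
by rewrite /c -mulmxA MB -mulmxA M2x !mulmx0 mxE.
Qed.

(** Rank reduction applied to [A - 1] writes [A] as a product of invertible
    matrices [1 + u v]; those that are transvections are products of two
    dilatations with the same direction [u], provided that the field has an
    element [c0] other than [0] and [-1]. *)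
Lemma unitmx_dilatations (P : 'M[F]_n -> Prop) (c0 : F) :
  c0 != 0 -> 1 + c0 != 0 -> P 1%:M ->
  (forall A B, A \in unitmx -> B \in unitmx -> P A -> P B -> P (A *m B)) ->
  (forall u v, (v *m u) 0 0 != 0 -> 1 + (v *m u) 0 0 != 0 ->
     P (pseudorefl u v)) ->
  forall A, A \in unitmx -> P A.
Proof.
move=> nz0 nz1 P1 PM Pdil.
have Prk u v : 1 + (v *m u) 0 0 != 0 -> P (pseudorefl u v).
  move=> nz; have [vu|] := eqVneq ((v *m u) 0 0) 0; last by move/Pdil; apply.
  have [->|/cV0Pn[i ui]] := eqVneq u 0.
    by rewrite /pseudorefl mul0mx addr0.
  (* [(1 + u a) (1 + u b)] is [1 + u (a + b + (a u) b)]; for [a u = c0] this is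
     the given transvection as soon as [a = v - (1 + c0) b], which forces the
     value of [b u]. *)
  pose b : 'rV[F]_n := (- c0 / (1 + c0) / u i 0) *: delta_mx 0 i.
  have bu : (b *m u) 0 0 = - c0 / (1 + c0).
    by rewrite -scalemxAl -rowE !mxE divfK.
  pose a := v - (1 + c0) *: b.
  have au : (a *m u) 0 0 = c0.
    rewrite mulmxBl -scalemxAl mxE vu add0r mxE mxE bu.
    by rewrite mulrC divfK // opprK.
  have -> : v = a + b + (a *m u) 0 0 *: b.
    by rewrite au /a -addrA -{2}[b]scale1r -scalerDl subrK.
  have nbu : 1 + (b *m u) 0 0 != 0.
    by rewrite bu -{1}(divff nz1) -mulrDl addrK mulf_neq0 ?oner_eq0 ?invr_eq0.
  rewrite -pseudoreflM; apply: PM; rewrite ?pseudorefl_unit ?au ?nbu //.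
    by apply: Pdil; rewrite au.
  by apply: Pdil => //; rewrite bu !mulf_neq0 ?oppr_eq0 ?invr_eq0.
move=> A; have [r] := ubnP (\rank (A - 1%:M)%R).
elim: r A => // r IH A; rewrite ltnS => rA uA.
have [A1|nzM] := eqVneq (A - 1%:M) 0.
  by move/eqP: A1; rewrite subr_eq0 => /eqP->.
set M := A - 1%:M in nzM rA.
have nzM' : M *m invmx A != 0.
  apply: contraNneq nzM => /(congr1 (mulmx^~ A)).
  by rewrite mulmxKV // mul0mx => ->.
have [y [yM yM']] := two_mx_neq0 nzM nzM'.
have trN0 (w : 'rV[F]_n) : w != 0 -> w^T != 0.
  by apply: contra_neq => /(congr1 trmx); rewrite trmxK trmx0.
have [z [zM zM']] := two_mx_neq0 (trN0 _ yM) (trN0 _ yM').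
pose x := z^T; pose c := (y *m M *m x) 0 0.
have scal (w : 'rV[F]_n) : z *m w^T != 0 -> (w *m x) 0 0 != 0.
  have -> : w *m x = (z *m w^T)^T by rewrite trmx_mul trmxK.
  rewrite mxE; apply: contraNneq => e0.
  by apply/eqP/matrixP => i j; rewrite !ord1 e0 mxE.
have nzc : c != 0 := scal _ zM.
(* With these vectors, [A (1 + u v) - 1] is the Wedderburn reduction of [M]; the
   factor [1 + u v] is invertible because [y (M A^-1) x] is nonzero. *)
pose v := y *m M; pose u := - c^-1 *: (invmx A *m (M *m x)).
have vu : 1 + (v *m u) 0 0 = c^-1 * (y *m (M *m invmx A) *m x) 0 0.
  have -> : v *m u = - c^-1 *: (y *m M *m x - y *m (M *m invmx A) *m x).
    rewrite /v /u -scalemxAr; congr (_ *: _).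
    rewrite -mulmxBl -mulmxBr -{3}[M]mulmx1 -mulmxBr.
    have -> : 1%:M - invmx A = invmx A *m M by rewrite mulmxBr mulVmx // mulmx1.
    by rewrite !mulmxA.
  have subE (X Z : 'M[F]_1) : (X - Z) 0 0 = X 0 0 - Z 0 0 by rewrite !mxE.
  rewrite mxE subE -/c mulNr mulrBr mulVf //.
  by rewrite opprB addrCA subrr addr0.
have nz : 1 + (v *m u) 0 0 != 0.
  by rewrite vu mulf_neq0 ?invr_eq0 // scal.
have uS := pseudorefl_unit nz.
have uAS : A *m pseudorefl u v \in unitmx by rewrite unitmx_mul uA.
have ASE : A *m pseudorefl u v - 1%:M = M - c^-1 *: (M *m x *m (y *m M)).
  have Au : A *m u = - c^-1 *: (M *m x).
    by rewrite /u -scalemxAr mulmxA mulmxV // mul1mx.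
  by rewrite /pseudorefl mulmxDr mulmx1 addrAC -/M mulmxA Au -scalemxAl scaleNr.
have PAS : P (A *m pseudorefl u v).
  apply: IH => //; rewrite ASE; apply: leq_trans rA; exact: wedderburn.
have iS := pseudorefl_inv nz.
rewrite -[A]mulmx1 -iS mulmxA; apply: PM => //.
  by have [] := mulmx1_unit iS.
apply: Prk; rewrite -scalemxAl mxE mulNr -{1}(mulVf nz) -mulrBr.
by rewrite addrK mulf_neq0 ?invr_eq0 ?oner_eq0.
Qed.

End Matrices.

Lemma diag_mxM (F : fieldType) n (r s : 'rV[F]_n) :
  diag_mx r *m diag_mx s = diag_mx (\row_j (r 0 j * s 0 j)).
Proof.
apply/matrixP => i j; rewrite mul_diag_mx !mxE mulrnAr.
by case: eqP => [->|]; rewrite ?mulr0n.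
Qed.

Lemma diag_mxC (F : fieldType) n (r s : 'rV[F]_n) :
  diag_mx r *m diag_mx s = diag_mx s *m diag_mx r.
Proof.
by rewrite !diag_mxM; congr diag_mx; apply/rowP => j; rewrite !mxE mulrC.
Qed.

Section Diagonal.
Variables (F : fieldType) (n : nat).

Definition base : 'rV[F]_n.+1 := delta_mx 0 0.

Definition dil (i : 'I_n.+1) (s : F) : 'M[F]_n.+1 :=
  diag_mx (\row_j (if j == i then s else 1)).

Lemma dil_unit i s : s != 0 -> dil i s \in unitmx.
Proof.
move=> nz; apply: diag_unitmx => j; rewrite mxE.
by case: (j == i); rewrite ?oner_eq0.
Qed.

Lemma dilE s : dil 0 s = pseudorefl base^T ((s - 1) *: base).
Proof.
apply/matrixP => i j; rewrite !mxE big_ord1 !mxE !eqxx /=.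
case: (eqVneq i j) => [<-|ij]; rewrite ?mulr1n ?mulr0n.
  case: (i == 0); rewrite ?mulr1 ?mulr0 ?mul1r ?mul0r ?addr0 //.
  by rewrite addrCA subrr addr0.
case: (eqVneq i 0) ij => [->|i0] ij; last by rewrite mul0r addr0.
by rewrite eq_sym (negPf ij) !mulr0 addr0.
Qed.

(** A basis that starts with the direction [u] of the dilatation and continues
    in its axis, the kernel of [v], conjugates it to the diagonal form. *)
Lemma dilatation_conj (u : 'cV[F]_n.+1) (v : 'rV[F]_n.+1) :
  (v *m u) 0 0 != 0 ->
  exists2 g, g \in unitmx &
    pseudorefl u v *m g = g *m dil 0 (1 + (v *m u) 0 0).
Proof.
set c := (v *m u) 0 0 => nzc.
have nzu : u^T != 0.
  apply: contraNneq nzc => /(congr1 trmx); rewrite trmxK trmx0 /c => ->.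
  by rewrite mulmx0 mxE.
have fu : row_free (u^T : 'M_(1, 1 + n)) by rewrite /row_free rank_rV nzu.
have [g0 ug0 g0u] := row_free_complete fu.
pose g1 : 'M[F]_n.+1 := g0^T.
have g1b : g1 *m base^T = u.
  rewrite -trmx_mul /base -rowE -[RHS]trmxK -[u^T]g0u; congr trmx.
  by apply/rowP => j; rewrite !mxE; congr (g0 _ j); apply: val_inj.
pose v1 := v *m g1; have v1b : (v1 *m base^T) 0 0 = c by rewrite -mulmxA g1b.
pose v2 := base - c^-1 *: v1.
have bb : base *m base^T = 1%:M.
  rewrite /base trmx_delta mul_delta_mx.
  by apply/matrixP => i j; rewrite !ord1 !mxE.
have v2b : (v2 *m base^T) 0 0 = 0.
  have subE (X Z : 'M[F]_1) : (X - Z) 0 0 = X 0 0 - Z 0 0 by rewrite !mxE.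
  rewrite mulmxBl -scalemxAl subE bb mxE [X in _ - X]mxE v1b mulVf //.
  by rewrite subrr.
pose g := g1 *m pseudorefl base^T v2.
have ug : g \in unitmx.
  rewrite unitmx_mul unitmx_tr ug0 /=; apply: pseudorefl_unit.
  by rewrite v2b addr0 oner_eq0.
have gb : g *m base^T = u.
  rewrite /g /pseudorefl -mulmxA mulmxDl mul1mx -mulmxA.
  by rewrite [v2 *m _]mx11_scalar v2b mul_mx_scalar scale0r addr0 g1b.
have vg : v *m g = c *: base.
  rewrite /g mulmxA -/v1 /pseudorefl mulmxDr mulmx1 mulmxA.
  rewrite [v1 *m _]mx11_scalar v1b mul_scalar_mx /v2 scalerBr scalerA.
  by rewrite mulfV // scale1r addrCA subrr addr0.
exists g => //; rewrite dilE addrAC subrr add0r /pseudorefl mulmxDl mul1mx.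
by rewrite -mulmxA vg mulmxDr mulmx1 mulmxA gb.
Qed.

End Diagonal.

(** * Moving a birational map to the base point *)

Section Pointing.
Variables (k : fieldType) (n : nat).
Implicit Types (f : bir k n) (F G : ptuple k n) (A : 'M[k]_n.+1).
Implicit Types (p : 'rV[k]_n.+1).
Notation base := (base k n).

Lemma represents_hinverse f F G :
  represents f F -> represents (f^-1)%g G -> hinverse F G.
Proof.
have half g P Q : represents g P -> represents (g^-1)%g Q ->
    (exists i, tnth (hcomp P Q) i != 0) /\ hsim (hcomp P Q) (hid k n).
  move=> rP rQ; have rPQ := represents_mul rP rQ; split.
    by case: (represents_hmap rPQ).
  by apply/(represents_eq rPQ (represents_one k n)); rewrite mulgV.
move=> rF rG; split; first exact: represents_hmap rG.
  exact: half rF rG.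
by apply: half rG _; rewrite invgK.
Qed.

(** The coordinates at the source and at the target are chosen independently, so
    that the base point stands for [p] on one side and for its image on the
    other. *)
Lemma fixes_base_conj f F G A A' p : represents f F -> hinverse F G ->
  A \in unitmx -> A' \in unitmx -> base *m A^T = p ->
  base *m A'^T = eval_tuple F p -> eval_tuple G (eval_tuple F p) != 0 ->
  fixes_base ((lin A')^-1 * f * lin A)%g.
Proof.
move=> rF iFG uA uA' Ap A'q nzp.
have uiA : invmx A \in unitmx by rewrite unitmx_inv.
have uiA' : invmx A' \in unitmx by rewrite unitmx_inv.
pose H := compose (compose (lin_tuple (invmx A')) F) (lin_tuple A).
pose H' := compose (compose (lin_tuple (invmx A)) G) (lin_tuple A').
have rH : represents ((lin A')^-1 * f * lin A)%g H.
  rewrite -(linV uA').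
  by do !apply: represents_mul => //; apply: represents_lin.
have rH' : represents (((lin A')^-1 * f * lin A)^-1)%g H'.
  rewrite !invgM invgK mulgA -(linV uA).
  apply: represents_mul; last exact: represents_lin.
  by apply: represents_mul; [exact: represents_lin | exact: represents_inv iFG].
have iH := represents_hinverse rH rH'.
have nzv : base != 0.
  by apply/rV0Pn; exists 0; rewrite mxE !eqxx oner_eq0.
have nz_p : p != 0.
  apply: contraNneq nzv => p0; move/(congr1 (mulmx^~ (invmx A)^T)): Ap.
  by rewrite p0 mul0mx -mulmxA -trmx_mul mulVmx // trmx1 mulmx1 => ->.
have [hG [nFG sFG] [nGF sGF]] := iFG.
have cGF : collinear (tnth (compose G F)) (fun i => 'X_i).
  by move=> i j; have := sGF i j; rewrite !(tnth_mktuple (fun i => 'X_i)).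
have [c nzc cE] := eval_inverse nz_p cGF nzp.
have bH : eval_tuple H base = base.
  rewrite /H !eval_compose !eval_lin Ap -A'q -mulmxA -trmx_mul mulVmx //.
  by rewrite trmx1 mulmx1.
have bH' : eval_tuple H' base = c *: base.
  rewrite /H' !eval_compose !eval_lin A'q cE -Ap -scalemxAl -mulmxA -trmx_mul.
  by rewrite mulVmx // trmx1 mulmx1.
have evE P e : eval_tuple P base = e *: base ->
    forall i, meval (@basept n k) (tnth P i) = e * basept k i.
  move=> bP i; have := congr1 (fun v : 'rV_n.+1 => v 0 i) bP.
  rewrite !mxE eqxx /= => <-; apply: meval_eq => j.
  by rewrite mxE eqxx.
have [hH' [_ sHH'] [_ sH'H]] := iH.
exists H, H', 1, c; split; [split | exact: oner_neq0 | exact: nzc | exact: rH].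
- by case: (represents_hmap rH).
- by case: hH'.
- by move=> i j; have := sH'H i j; rewrite !(tnth_mktuple (fun i => 'X_i)).
- by move=> i j; have := sHH' i j; rewrite !(tnth_mktuple (fun i => 'X_i)).
- by apply: evE; rewrite scale1r.
- exact: evE.
Qed.

Lemma eval_hid p : eval_tuple (hid k n) p = p.
Proof. by rewrite -lin_tuple1 eval_lin trmx1 mulmx1. Qed.

Lemma fixes_base_lin A : A \in unitmx -> base *m A^T = base ->
  fixes_base (lin A).
Proof.
move=> uA Ab; have nzv : base != 0.
  by apply/rV0Pn; exists 0; rewrite mxE !eqxx oner_eq0.
have hh : hinverse (hid k n) (hid k n).
  have r1 := represents_one k n.
  by apply: (represents_hinverse r1); rewrite invg1.
have := fixes_base_conj (represents_one k n) hh uA (unitmx1 k _) Ab.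
rewrite trmx1 mulmx1 !eval_hid lin1 invg1 !mul1g.
by apply.
Qed.

(** Both conditions are the nonvanishing of a polynomial, and the field is
    infinite. *)
Lemma moved_point f F G : infinite_set [set: k] ->
  represents f F -> hinverse F G -> f <> 1%g ->
  exists p, eval_tuple G (eval_tuple F p) != 0 /\
    exists i j, p 0 i * eval_tuple F p 0 j != p 0 j * eval_tuple F p 0 i.
Proof.
move=> k_inf rF [_ _ [[l nl] _]] f1.
have [i [j ij]] : exists i j, tnth F i * 'X_j - tnth F j * 'X_i != 0.
  apply: contra_notP f1 => h; apply/(represents_eq rF (represents_one k n)).
  move=> i j; rewrite !(tnth_mktuple (fun i => 'X_i)); apply/eqP.
  rewrite -subr_eq0; apply: contra_notT h => ij.
  by exists i, j.
have [v] := mpoly_nonroot k_inf (mulf_neq0 nl ij).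
rewrite mevalM mulf_eq0 negb_or => /andP[nv1 nv2].
pose p : 'rV[k]_n.+1 := \row_a v a.
have pE P a : eval_tuple P p 0 a = meval v (tnth P a).
  by rewrite mxE; apply: meval_eq => b; rewrite mxE.
exists p; split.
  rewrite -eval_compose; apply/rV0Pn; exists l.
  by rewrite pE.
exists j, i; rewrite !pE [p 0 j]mxE [p 0 i]mxE -subr_eq0.
by move: nv2; rewrite mevalB !mevalM !mevalXU mulrC [X in _ - X]mulrC.
Qed.

Lemma regular_point f F G : infinite_set [set: k] ->
  represents f F -> hinverse F G ->
  exists p, [/\ p != 0, eval_tuple F p != 0 &
    eval_tuple G (eval_tuple F p) != 0].
Proof.
move=> k_inf rF [_ _ [[l nl] _]].
have [[j nj] _] := represents_hmap rF.
have nX : 'X_ord0 != 0 :> {mpoly k[n.+1]} by rewrite -msupp_eq0 msuppX.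
have [v] := mpoly_nonroot k_inf (mulf_neq0 (mulf_neq0 nX nj) nl).
rewrite !mevalM !mulf_eq0 !negb_or mevalXU => /andP[/andP[n1 n2] n3].
have pE P a : eval_tuple P (\row_a v a) 0 a = meval v (tnth P a).
  by rewrite mxE; apply: meval_eq => b; rewrite mxE.
exists (\row_a v a); split; apply/rV0Pn.
- by exists ord0; rewrite mxE.
- by exists j; rewrite pE.
- by exists l; rewrite -eval_compose pE.
Qed.

End Pointing.

(** * Dilatations *)

Section Dilatations.
Variables (k : fieldType) (n : nat).
Implicit Types (s t : k).

Lemma tperm_dil (a b c : 'I_n.+1) s :
  tperm_mx a b *m dil c s = dil (tperm a b c) s *m tperm_mx a b.
Proof.
apply/matrixP => i j; rewrite mul_mx_diag mul_diag_mx !mxE.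
case: (tperm a b i =P j) => [<-|_]; last by rewrite mulr0 mul0r.
by rewrite mulr1 mul1r (canF_eq (tpermK a b)).
Qed.

Lemma dilM (i : 'I_n.+1) s t : dil i s *m dil i t = dil i (s * t).
Proof.
rewrite diag_mxM; suff -> : \row_j ((\row_l if l == i then s else 1) 0 j *
    (\row_l if l == i then t else 1) 0 j) =
    \row_j (if j == i then s * t else 1) by [].
by apply/rowP => j; rewrite !mxE; case: (j == i); rewrite ?mulr1.
Qed.

Lemma lin_dilX (i : 'I_n.+1) s m : s != 0 ->
  (lin (dil i s) ^+ m)%g = lin (dil i (s ^+ m)).
Proof.
move=> nz; elim: m => [|m IH].
  rewrite expg0 expr0; have -> : dil i (1 : k) = 1%:M; last by rewrite lin1.
  by apply/matrixP => a b; rewrite !mxE; case: (b == i); rewrite ?if_same.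
have e : dil i s *m dil i (s ^+ m) = dil i (s ^+ m.+1) by rewrite dilM exprS.
by rewrite expgS IH -e (linM (dil_unit i nz) (dil_unit i (expf_neq0 m nz))).
Qed.

(** The diagonal map [(t, 1, ..., 1)] is paired with [(1, t, ..., t)], its
    inverse up to the scalar [t], so that both are polynomial in [t]. *)
Lemma dilatation_family (K : closedFieldType) (iota : {rmorphism k -> K}) :
  pointed_family iota 'X (fun t => lin (dil (0 : 'I_n.+1) t)).
Proof.
pose R := {mpoly k[2]}; pose x : R := 'X_0.
pose dt (c : 'I_n.+1 -> R) : n.+1.-tuple {mpoly R[n.+1]} :=
  [tuple c i *: 'X_i | i < n.+1].
pose c1 (i : 'I_n.+1) := if i == 0 then x else 1.
pose c2 (i : 'I_n.+1) := if i == 0 then 1 else x.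
have nzx : x != 0 by rewrite -msupp_eq0 msuppX.
have dt_homog c i : tnth (dt c) i \is 1.-homog.
  rewrite tnth_mktuple; apply: rpredZ.
  by rewrite dhomogX; apply/eqP; apply: mdeg1.
have dt_comp c c' : (forall i, c i * c' i = x) ->
    collinear (tnth (compose (dt c) (dt c'))) (fun i => 'X_i).
  move=> cc; have E i : tnth (compose (dt c) (dt c')) i = x *: 'X_i.
    rewrite composeE tnth_mktuple comp_mpolyZ comp_mpolyXU -tnth_nth.
    by rewrite tnth_mktuple scalerA cc.
  by move=> i j; rewrite !E -!scalerAl mulrC.
have dt_base c i : meval (@basept n R) (tnth (dt c) i) = c 0 * basept R i.
  rewrite tnth_mktuple mevalZ mevalXU /basept.
  by case: (i =P 0) => [->|_]; rewrite ?mulr0.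
exists (dt c1), (dt c2), x, 1; split.
- split.
  + by exists 1%N.
  + by exists 1%N.
  + apply: dt_comp => i; rewrite /c1 /c2.
    by case: (i == 0); rewrite ?mulr1 ?mul1r.
  + apply: dt_comp => i; rewrite /c1 /c2.
    by case: (i == 0); rewrite ?mulr1 ?mul1r.
  + by move=> i; rewrite dt_base /c1 eqxx.
  + by move=> i; rewrite dt_base /c2 eqxx.
- exact: nzx.
- exact: oner_neq0.
- move=> z; rewrite rmorph1 oner_eq0 /x evX; split=> //.
  have := open_lineP z; rewrite map_polyX hornerX => e.
  by apply: contra_eq_neq e => ->; rewrite mulr0 eq_sym oner_eq0.
move=> t; rewrite hornerX => nzt.
suff -> : map_tuple_mpoly (meval (line_pt 'X t)) (dt c1) =
    lin_tuple (dil (0 : 'I_n.+1) t) by apply: represents_lin; apply: dil_unit.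
apply: eq_from_tnth => i; rewrite !tnth_mktuple map_mpolyZ /lin_form /=.
rewrite (bigD1 i) //= big1 ?addr0 => [|j ji]; last first.
  by rewrite !mxE (eq_sym i j) (negPf ji) mulr0n scale0r.
rewrite map_mpolyXU !mxE eqxx mulr1n /c1; congr (_ *: _).
by case: (i == 0); rewrite ?meval1 // mevalXU.
Qed.

End Dilatations.

Definition lin_dil (k : fieldType) n (i : 'I_n.+1) (s : k) : bir k n :=
  lin (dil i s).

(** * Closed normal subgroups *)

Section NormalSubgroup.
Variables (k : fieldType) (K : closedFieldType) (iota : {rmorphism k -> K}).
Variable n' : nat.
Notation n := n'.+1.
Hypothesis k_inf : infinite_set [set: k].
Variable N : set (bir k n).
Hypothesis N_normal : normal_subgroup N.
Hypothesis N_closed : zariski_closed iota N.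
Implicit Types (A B g : 'M[k]_n.+1) (r : 'rV[k]_n.+1) (s t : k).
Notation base := (base k n).

Let N1 : N 1%g. Proof. by case: N_normal. Qed.
Let NM x y : N x -> N y -> N (x * y)%g.
Proof. by case: N_normal => _ h _ _; apply: h. Qed.
Let NV x : N x -> N x^-1%g. Proof. by case: N_normal => _ _ h _; apply: h. Qed.
Let NJ x y : N x -> N (x ^ y)%g. Proof. by case: N_normal => _ _ _; apply. Qed.

Lemma normal_lin_conj A B g : A \in unitmx -> B \in unitmx -> g \in unitmx ->
  B *m g = g *m A -> N (lin A) -> N (lin B).
Proof.
move=> uA uB ug e NA; have := congr1 (@lin k n) e.
rewrite (linM uB ug) (linM ug uA) => e'.
suff -> : lin B = (lin A ^ (lin g)^-1)%g by apply: NJ.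
by rewrite /conjg invgK mulgA -e' mulgK.
Qed.

Lemma normal_limit (chi : k -> bir k n) : pointed_family iota 1 chi ->
  (forall t, t != 0 -> N (chi t)) -> N (chi 0).
Proof.
move=> fchi Nchi.
apply: (closed_pointed_family (S := fun t => t != 0) N_closed fchi).
- move=> q q0; have : q * 'X = 0.
    apply: contrapT => /eqP nz; have [t] := poly_nonroot k_inf nz.
    rewrite hornerM hornerX mulf_eq0 negb_or => /andP[+ nzt].
    by rewrite q0 ?eqxx.
  by move/eqP; rewrite mulf_eq0 polyX_eq0 orbF => /eqP.
- by move=> t nzt _; apply: Nchi.
- by rewrite hornerC oner_eq0.
Qed.

Lemma block_diag_comm (L : 'M[k]_n.+1) s : block_diag L ->
  L *m dil 0 s = dil 0 s *m L.
Proof.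
move=> bL; apply/matrixP => i j; rewrite mul_mx_diag mul_diag_mx !mxE.
have [->|i0] := eqVneq i 0; have [->|j0] := eqVneq j 0.
- by rewrite mulrC.
- by rewrite (bL j j0).1 mul0r mulr0.
- by rewrite (bL i i0).2 mul0r mulr0.
- by rewrite mulr1 mul1r.
Qed.

(** In coordinates where [f] sends the first coordinate point [p] to the second
    one [q], let [a] and [b] be the dilatations of ratio [s] with centres [q]
    and [p].  On the tangent space at its centre a dilatation acts as a scalar,
    so [f^-1 a f] and [b] have the same differential at [p], whatever that of
    [f] may be.  Hence the commutator of [f] and [a], contracted towards [p],
    tends to [b^-1 a]. *)
Lemma commutator_limit (f : bir k n) s : f <> 1%g -> N f -> s != 0 ->
  N ((lin (dil 0 s)%R)^-1 * lin (dil 1 s)%R)%g.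
Proof.
move=> f1 Nf nzs; have [F [G [rF iFG]]] := represents_ex f.
have [p [nzp [i [j pij]]]] := moved_point k_inf rF iFG f1.
pose q := eval_tuple F p; pose M : 'M[k]_(2, 2 + n') := col_mx p q.
have fM : row_free M.
  (* Eliminating between the columns [i] and [j], whose minor is nonzero. *)
  rewrite -kermx_eq0; apply/eqP/row_matrixP => l; rewrite row0.
  have : row l (kermx M) *m M = 0 by rewrite -row_mul mulmx_ker row0.
  move: (row l (kermx M)) => w wM.
  pose a : k := lsubmx (w : 'M_(1, 1 + 1)) 0 0.
  pose b : k := rsubmx (w : 'M_(1, 1 + 1)) 0 0.
  have wab : w = row_mx (a%:M : 'M_1) (b%:M : 'M_1).
    by rewrite -!mx11_scalar hsubmxK.
  have wE c : a * p 0 c + b * q 0 c = 0.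
    have := congr1 (fun v : 'rV_n.+1 => v 0 c) wM.
    rewrite wab (mul_row_col (a%:M : 'M_1) (b%:M : 'M_1) p q).
    by rewrite !mul_scalar_mx !mxE.
  pose D := p 0 i * q 0 j - p 0 j * q 0 i.
  have nzD : D != 0 by rewrite subr_eq0.
  have a0 : a = 0.
    apply: (mulIf nzD); rewrite mul0r.
    transitivity ((a * p 0 i + b * q 0 i) * q 0 j -
      (a * p 0 j + b * q 0 j) * q 0 i).
      rewrite !mulrDl opprD addrACA -!mulrA [q 0 i * _]mulrC subrr addr0.
      by rewrite -mulrBr.
    by rewrite !wE !mul0r subrr.
  have b0 : b = 0.
    apply: (mulIf nzD); rewrite mul0r.
    transitivity ((a * p 0 j + b * q 0 j) * p 0 i -
      (a * p 0 i + b * q 0 i) * p 0 j).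
      rewrite !mulrDl opprD addrACA -!mulrA [p 0 j * _]mulrC subrr add0r.
      by rewrite -mulrBr [q 0 j * _]mulrC [q 0 i * _]mulrC.
    by rewrite !wE !mul0r subrr.
  by rewrite wab a0 b0 raddf0 row_mx0.
have [g0 ug0 g0M] := row_free_complete fM.
pose A : 'M[k]_n.+1 := g0^T; pose w : 'M[k]_n.+1 := tperm_mx 0 1.
have uA : A \in unitmx by rewrite unitmx_tr.
have uw : w \in unitmx by rewrite unitmx_perm.
have rows (a : 'I_2) (b : 'I_n.+1) : a = b :> nat -> row b g0 = row a M.
  move=> ab; rewrite -g0M; apply/rowP => c; rewrite !mxE; congr (g0 _ c).
  exact: val_inj.
have bA : base *m A^T = p.
  rewrite trmxK -rowE (rows 0) //; apply/rowP => c; rewrite !mxE.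
  by case: splitP => // a _; rewrite ord1.
have bAw : base *m (A *m w)^T = q.
  rewrite trmx_mul trmxK mulmxA /w tr_tperm_mx -rowE.
  have -> : row 0 (tperm_mx 0 1 : 'M[k]_n.+1) = delta_mx 0 1.
    by apply/rowP => c; rewrite !mxE tpermL eqxx /= eq_sym.
  rewrite -rowE (rows 1) //; apply/rowP => c; rewrite mxE.
  have -> : 1 = rshift 1 (0 : 'I_1) :> 'I_(1 + 1) by apply: val_inj.
  by rewrite [LHS]col_mxEd.
have uAw : A *m w \in unitmx by rewrite unitmx_mul uA.
(* In the coordinates given by [A] the map [f] becomes [f'], which is [h], a
   local isomorphism fixing [p], followed by the exchange [w] of [p] and [q]. *)
have fh := fixes_base_conj rF iFG uA uAw bA bAw nzp.
pose f' := (f ^ lin A)%g; pose h := ((lin (A *m w))^-1 * f * lin A)%g.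
have f'E : f' = (lin w * h)%g.
  by rewrite /h (linM uA uw) invgM !mulgA mulgV mul1g /f' /conjg mulgA.
pose alpha := lin (dil 1 s : 'M[k]_n.+1).
pose beta := lin (dil 0 s : 'M[k]_n.+1).
have ud (i0 : 'I_n.+1) : dil i0 s \in unitmx := dil_unit i0 nzs.
have alphaE : (lin w * beta = alpha * lin w)%g.
  have := congr1 (@lin k n) (tperm_dil 0 1 0 s); rewrite tpermL.
  by rewrite (linM uw (ud 0)) (linM (ud 1) uw).
have Ncomm : N (h^-1 * beta^-1 * h * alpha)%g.
  rewrite (conj_commutator h alphaE) -f'E.
  by apply: NM; [apply: NV|]; do !apply: NJ.
have [L [chi [[uL bL] fchi chi0 chit]]] :=
  contraction_family iota (ltn0Sn n') fh.
(* Up to a scalar, [beta] is the homothety of ratio [s^-1]. *)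
have nzs' : s^-1 != 0 by rewrite invr_eq0.
have betaE : homothety_mx n s^-1 = s^-1 *: dil 0 s.
  apply/matrixP => a b; rewrite !mxE mulrnAr; congr (_ *+ _).
  by case: (a =P ord0) => _; rewrite ?mulVf ?mulr1.
have fbeta : fixes_base beta.
  rewrite /beta -(lin_scale nzs' (ud 0)) -betaE.
  apply: fixes_base_lin; first exact: homothety_unit.
  rewrite tr_diag_mx -rowE; apply/rowP => c; rewrite !mxE eqxx expr0.
  by rewrite [in LHS]eq_sym.
have falpha : fixes_base alpha.
  apply: fixes_base_lin; first exact: ud.
  rewrite tr_diag_mx -rowE; apply/rowP => c.
  by rewrite !mxE eqxx /= eq_sym.
pose psi t := ((chi t)^-1 * beta^-1 * chi t * alpha)%g.
have fpsi : pointed_family iota 1 psi.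
  have fV := pointed_family_inv (pointed_family_const iota 1 fbeta).
  have fA := pointed_family_const iota 1 falpha.
  have fchiV := pointed_family_inv fchi.
  have fVV := pointed_family_mul (pointed_family_mul fchiV fV) fchi.
  exact: pointed_family_mul fVV fA.
have psi0 : psi 0 = (beta^-1 * alpha)%g.
  have LC : (lin L * beta = beta * lin L)%g.
    have := congr1 (@lin k n) (block_diag_comm s bL).
    by rewrite (linM uL (ud 0)) (linM (ud 0) uL).
  have := commute_cancel alpha LC.
  by rewrite -chi0.
rewrite -/alpha -/beta -psi0; apply: normal_limit fpsi _ => t nzt.
rewrite /psi (chit _ nzt); have uh := homothety_unit n nzt.
have fix_lam i0 :
    (lin (dil i0 s : 'M[k]_n.+1) ^ lin (homothety_mx n t))%g = lin (dil i0 s).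
  apply: commute_conj; have := congr1 (@lin k n) (diag_mxC _ _ :
    dil i0 s *m homothety_mx n t = homothety_mx n t *m dil i0 s).
  by rewrite (linM (ud i0) uh) (linM uh (ud i0)).
rewrite (conj_fixed _ (fix_lam 1) (fix_lam 0)); exact: NJ.
Qed.

Variable f0 : bir k n.
Hypotheses (N_f0 : N f0) (f0_neq1 : f0 <> 1%g).

Lemma tperm_lin_dil (a b c : 'I_n.+1) s : s != 0 ->
  (lin_dil c s ^ (lin (tperm_mx a b))^-1)%g = lin_dil (tperm a b c) s.
Proof.
move=> nz; have uw : tperm_mx a b \in @unitmx k n.+1 by rewrite unitmx_perm.
have := congr1 (@lin k n) (tperm_dil a b c s).
rewrite (linM uw (dil_unit c nz)) (linM (dil_unit _ nz) uw) => e.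
by rewrite /conjg invgK mulgA e mulgK.
Qed.

Lemma lin_dil_ratio (i : 'I_n.+1) s : s != 0 ->
  N ((lin_dil 0%R s)^-1 * lin_dil i s)%g.
Proof.
move=> nz; have [->|i0] := eqVneq i 0; first by rewrite mulVg.
have NC : N ((lin_dil 0%R s)^-1 * lin_dil 1%R s)%g :=
  commutator_limit f0_neq1 N_f0 nz.
have e0 := tperm_lin_dil 1%R i 0%R nz; have e1 := tperm_lin_dil 1%R i 1%R nz.
rewrite (tpermD (isT : (1%R : 'I_n.+1) != 0%R) i0) in e0.
rewrite tpermL in e1.
have := NJ (lin (tperm_mx 1%R i))^-1 NC; rewrite (conj_ratio e0 e1); exact.
Qed.

(** Modulo [N] the dilatations of ratio [s] centred at the coordinate points all
    agree, while their product is scalar; so the power [s ^ (n + 1)] of the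
    ratio gives an element of [N]. *)
Lemma lin_dil_power s : s != 0 -> N (lin_dil 0%R (s ^+ n.+1)).
Proof.
move=> nz; pose D (l : seq 'I_n.+1) : 'M[k]_n.+1 :=
  diag_mx (\row_j s ^+ count_mem j l).
have uD l : D l \in unitmx by apply: diag_unitmx => j; rewrite mxE expf_neq0.
have NDl l : N ((lin_dil 0%R s) ^- size l * lin (D l))%g.
  elim: l => [|i l IH].
    rewrite expg0 invg1 mul1g; have -> : D [::] = 1%:M; last by rewrite lin1.
    by apply/matrixP => a b; rewrite !mxE.
  have -> : D (i :: l) = dil i s *m D l.
    rewrite /D /dil diag_mxM; congr diag_mx; apply/rowP => j.
    by rewrite !mxE /= exprD (eq_sym i j); case: (j == i).
  rewrite (linM (dil_unit i nz) (uD l)) /= expgS invgM.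
  rewrite ratio_step; apply: NM IH; apply: NJ.
  exact: lin_dil_ratio.
have := NDl (enum 'I_n.+1).
have -> : D (enum 'I_n.+1) = s *: 1%:M.
  apply/matrixP => a b; rewrite !mxE (count_uniq_mem _ (enum_uniq _)) mem_enum.
  by rewrite expr1 mulr_natr.
rewrite (lin_scale nz (unitmx1 _ _)) lin1 mulg1 size_enum_ord => /NV.
by rewrite invgK lin_dilX.
Qed.

(** The ratios that are [n + 1]-st powers are dense in the multiplicative
    group. *)
Lemma lin_dil_all s : s != 0 -> N (lin_dil 0%R s).
Proof.
move=> nzs.
pose S t := exists2 r : k, r != 0 & t = r ^+ n.+1.
have := closed_pointed_family (S := S) N_closed (dilatation_family n iota).
move=> /(_ _ _ s); rewrite hornerX; apply=> //.
- move=> q qS; apply/eqP.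
  rewrite -(comp_poly_eq0 q (q := 'X^(n.+1))) ?size_polyXn //.
  apply: contrapT => /negP nzq.
  have nz : (q \Po 'X^(n.+1)) * 'X != 0 by rewrite mulf_neq0 ?polyX_eq0.
  have [r] := poly_nonroot k_inf nz.
  rewrite hornerM hornerX horner_comp hornerXn mulf_eq0 negb_or => /andP[+ nzr].
  by rewrite qS ?eqxx //; exists r.
- by move=> t [r nzr ->] _; apply: lin_dil_power.
Qed.

Lemma normal_lin A : A \in unitmx -> N (lin A).
Proof.
have nz : 'X * ('X + 1%:P) != 0 :> {poly k}.
  by rewrite mulf_neq0 ?polyX_eq0 // -size_poly_eq0 size_XaddC.
have [c] := poly_nonroot k_inf nz.
rewrite hornerM hornerD hornerX hornerC mulf_eq0 negb_or addrC => /andP[c0 c1].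
apply: (unitmx_dilatations (P := fun A => N (lin A)) c0 c1).
- by rewrite lin1.
- by move=> B C uB uC NB NC; rewrite (linM uB uC); apply: NM.
move=> u v vu0 vu1; have [g ug e] := dilatation_conj vu0.
have uR := pseudorefl_unit vu1.
exact: (normal_lin_conj (dil_unit 0 vu1) uR ug e (lin_dil_all vu1)).
Qed.

(** After linear changes of coordinates [f] becomes a local isomorphism [h] at
    the base point.  Homotheties belong to [N], so all conjugates of [h] by
    homotheties are equal to [h] modulo [N], and so is their linear limit. *)
Lemma normal_full (f : bir k n) : N f.
Proof.
have [F [G [rF iFG]]] := represents_ex f.
have [p [nzp0 nzq nzp]] := regular_point k_inf rF iFG.
have chart (v : 'rV[k]_n.+1) : v != 0 ->
    exists2 A, A \in unitmx & base *m A^T = v.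
  move=> nzv; have fv : row_free (v : 'M_(1, 1 + n)).
    by rewrite /row_free rank_rV nzv.
  have [g ug gv] := row_free_complete fv.
  exists (g^T : 'M[k]_n.+1); first by rewrite unitmx_tr.
  rewrite trmxK -rowE -gv; apply/rowP => j; rewrite !mxE.
  by congr (g _ j); apply: val_inj.
have [A uA Ap] := chart p nzp0; have [A' uA' A'q] := chart _ nzq.
have fh := fixes_base_conj rF iFG uA uA' Ap A'q nzp.
set h := (_ * lin A)%g in fh.
have [L [chi [[uL _] fchi chi0 chit]]] :=
  contraction_family iota (ltn0Sn n') fh.
have Nlim : N (h^-1 * chi 0)%g.
  have fhV := pointed_family_inv (pointed_family_const iota 1 fh).
  have fpsi := pointed_family_mul fhV fchi.
  apply: (normal_limit fpsi) => t nzt; rewrite (chit t nzt).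
  have NH := normal_lin (homothety_unit n nzt).
  by rewrite commutator_conj; apply: NM => //; apply: NJ; apply: NV.
have Nh : N h.
  have := NM (normal_lin uL) (NV Nlim).
  by rewrite chi0 invgM invgK mulgA mulgV mul1g.
have := NM (NM (normal_lin uA') Nh) (NV (normal_lin uA)).
by rewrite /h !mulgA mulgV mul1g mulgK.
Qed.

End NormalSubgroup.

Local Open Scope classical_set_scope.

Theorem theorem1 (k : fieldType) (K : closedFieldType) (iota : {rmorphism k -> K})
    (n : nat) (N : set (bir k n)) :
  (forall x : K, algebraicOver iota x) ->
  infinite_set [set: k] ->
  (1 <= n)%N ->
  normal_subgroup N ->
  zariski_closed iota N ->
  N = [set 1%g] \/ N = [set: bir k n].
Proof.
move=> _ k_inf n_gt0 nN cN; case: n => // n' in N n_gt0 nN cN *.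
have [[f [Nf f1]]|triv] := pselect (exists f, N f /\ f <> 1%g).
  right; apply/seteqP; split=> // g _.
  exact: (normal_full k_inf nN cN Nf f1 g).
left; apply/seteqP; split=> f /=; last by move=> ->; case: nN.
by move=> Nf; apply: contrapT => f1; apply: triv; exists f.
Qed.
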